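(* Fix $\rho\in(0,1]$ and consider the sparse Rademacher prior $\mathcal X_{\mathrm{spRade}}(\rho)$. For each $d\ge3$ there exists a bound $\lambda^*_{\mathrm{spRade}(\rho),d}$, with $\lim_{d\to\infty}\lambda^*_{\mathrm{spRade}(\rho),d}=2\sqrt{H(\rho)+\rho\log2}$, such that for every $d$: (1) if $\lambda<\lambda^*_{\mathrm{spRade}(\rho),d}$, then weak detection and weak recovery are impossible for $\mathrm{WT}(d,\lambda,\mathcal X_{\mathrm{spRade}}(\rho))$; (2) if $\lambda>2\sqrt{H(\rho)+\rho\log2}$, then strong detection and weak recovery are possible for $\mathrm{WT}(d,\lambda,\mathcal X_{\mathrm{spRade}}(\rho))$. Here $H(\rho)=-\rho\log\rho-(1-\rho)\log(1-\rho)$ is the binary entropy.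
   Context: Wigner tensor: for integers $d\ge2$, $n\ge1$, $\mathrm{WT}(d)=\mathrm{WT}_n(d)$ is the law of the symmetric tensor $W\in(\mathbb R^n)^{\otimes d}$ obtained by drawing $W'\in\mathbb R^{n^d}$ with i.i.d. $\mathcal N(0,2/n)$ entries and averaging it over all $d!$ permutations of the indices. Inner products of tensors are entrywise. Spiked model: a prior $\mathcal X=\{\mathcal X_n\}$ is a family of distributions on unit vectors of $\mathbb R^n$. For $\lambda\ge0$ (not depending on $n$), $\mathrm{WT}(d,\lambda,\mathcal X)$ is the law of $T=\lambda x^{\otimes d}+W$ with $x\sim\mathcal X_n$ and $W\sim\mathrm{WT}_n(d)$ independent. All statements are in the limit $n\to\infty$ with $d,\lambda$ fixed. Sparse Rademacher prior $\mathcal X_{\mathrm{spRade}}(\rho)$: a support of exactly $\rho n$ of the $n$ coordinates is chosen uniformly at random, the entries of $x$ on the support are i.i.d. uniform on $\{\pm1/\sqrt{\rho n}\}$, and all other entries are $0$ ($n$ ranges over values for which $\rho n$ is an integer). Convention: $0\log0=0$; $\log$ is natural. Detection and recovery: one is given a single sample from either $\mathrm{WT}(d,\lambda,\mathcal X)$ or $\mathrm{WT}(d)$, each chosen with probability $1/2$. Strong detection: decide which one with success probability $1-o(1)$ as $n\to\infty$. Weak detection: decide with success probability at least $\frac12+\varepsilon$ as $n\to\infty$, for some $\varepsilon>0$ not depending on $n$. Weak recovery: given a sample $T$ from $\mathrm{WT}(d,\lambda,\mathcal X)$, output a unit vector $\hat x=\hat x(T)$ with $\mathbb E[\langle x,\hat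 x\rangle^d]\ge\varepsilon$ as $n\to\infty$, for some $\varepsilon>0$ not depending on $n$. These are information-theoretic notions; there is no computational restriction. *)

(* Defs.v *)
From HB Require Import structures.
From mathcomp Require Import all_boot all_order all_fingroup all_algebra.
From mathcomp Require Import all_classical all_reals all_analysis.
From mathcomp Require Import measurable_realfun.
Import Order.TTheory GRing.Theory Num.Theory.
Import numFieldNormedType.Exports.

Set Implicit Arguments.
Unset Strict Implicit.
Unset Printing Implicit Defensive.

Local Open Scope classical_set_scope.
Local Open Scope ring_scope.

Section iid_law.
Context d (T : measurableType d) (R : realType).

Definition cons_pair k (p : T * k.-tuple T) : k.+1.-tuple T :=
  [tuple of p.1 :: p.2].

Lemma measurable_cons_pair k : measurable_fun setT (@cons_pair k).
Proof. by apply: measurable_cons; [exact: measurable_fst|exact: measurable_snd]. Qed.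

HB.instance Definition _ k := isMeasurableFun.Build _ _ _ _ (@cons_pair k)
  (@measurable_cons_pair k).

(* the k-fold product measure P^k on k-tuples *)
Fixpoint iid_law (P : probability T R) (k : nat) : probability (k.-tuple T) R :=
  match k with
  | 0 => \d_[tuple]
  | k'.+1 => distribution (P \x iid_law P k')%E (@cons_pair k')
  end.

Lemma iid_law_box (P : probability T R) k (A : 'I_k -> set T) :
  (forall i, measurable (A i)) ->
  iid_law P k [set t | forall i, A i (tnth t i)] = (\prod_(i < k) P (A i))%E.
Proof.
elim: k A => [|k IHk] A mA.
  rewrite big_ord0 /= diracE mem_set //=; first by case.
have mB : measurable [set t : k.-tuple T | forall i, A (lift ord0 i) (tnth t i)].
  rewrite (_ : [set _ | _] =
    \bigcap_(i in [set: 'I_k]) ((@tnth k T)^~ i @^-1` A (lift ord0 i))).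
    apply: fin_bigcap_measurable => // i _.
    by rewrite -[X in measurable X]setTI; exact: measurable_tnth.
  by apply/seteqP; split=> [t At i _|t At i]; [exact: At|exact: (At i)].
rewrite big_ord_recl -IHk //= /distribution /pushforward.
rewrite (_ : _ @^-1` _ = A ord0 `*`
  [set t : k.-tuple T | forall i, A (lift ord0 i) (tnth t i)]).
  by rewrite product_measure1E.
apply/seteqP; split=> [[x t] /= At|[x t] /= [Ax At] i].
  split; first by have := At ord0; rewrite tnth0.
  by move=> i; have := At (lift ord0 i); rewrite tnthS.
by case: (unliftP ord0 i) => [j|] ->; rewrite ?tnthS ?tnth0.
Qed.

(* the law of a uniformly chosen entry of s, entries being counted with
   multiplicity; the default value z only serves when s is empty *)
Definition uniform_law (z : T) (s : seq T) : probability T R :=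
  mnormalize (msum (fun i => \d_(nth z s i)) (size s)) \d_z.

Lemma uniform_lawE (z : T) (s : seq T) (A : set T) : (0 < size s)%N ->
  uniform_law z s A = ((count (mem A) s)%:R / (size s)%:R)%:E.
Proof.
move=> s0; pose m B := msum (fun i => \d_(nth z s i) : set T -> \bar R) (size s) B.
have E B : m B = (count (mem B) s)%:R%:E.
  rewrite /m /msum -sum1_count (big_nth z) big_mkord natr_sum -sumEFin.
  rewrite [RHS]big_mkcond; apply: eq_bigr => i _; rewrite /= diracE.
  by case: (nth z s i \in B).
have ET : m setT = (size s)%:R%:E.
  by rewrite E; congr (_%:R%:E); apply/eqP; rewrite -all_count; apply/allP => x _; rewrite /= in_setT.
transitivity (if (m setT == 0) || (m setT == +oo) then \d_z A
  else m A * ((fine (m setT))^-1)%:E)%E; first by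
  rewrite /m /uniform_law /= /mnormalize /=; case: ifP.
by rewrite ET E eqe pnatr_eq0 -leqn0 leqNgt s0 /= EFinM.
Qed.

End iid_law.

Section tensors.
Context (R : realType).

(* vectors of R^n and tensors of (R^n)^{(x) d}, represented as tuples, which
   carry the product sigma-algebra *)
Definition vec (n : nat) : Type := n.-tuple R.
Definition tensor (n d : nat) : Type := #|{ffun 'I_d -> 'I_n}|.-tuple R.

HB.instance Definition _ n := Measurable.on (vec n).
HB.instance Definition _ n d := Measurable.on (tensor n d).

Definition coef n d (t : tensor n d) (i : {ffun 'I_d -> 'I_n}) : R :=
  tnth t (enum_rank i).

Definition mktensor n d (f : {ffun 'I_d -> 'I_n} -> R) : tensor n d :=
  [tuple f (enum_val k) | k < #|{ffun 'I_d -> 'I_n}|].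

Lemma coef_mktensor n d (f : {ffun 'I_d -> 'I_n} -> R) i :
  coef (mktensor f) i = f i.
Proof. by rewrite /coef tnth_mktuple enum_rankK. Qed.

Definition dot n (x y : vec n) : R := \sum_(i < n) tnth x i * tnth y i.

Definition unit_vec n (x : vec n) : Prop := dot x x = 1.

Definition symmetrize n d (t : tensor n d) : tensor n d :=
  mktensor (fun i => (d`!)%:R^-1 *
    \sum_(s : {perm 'I_d}) coef t [ffun j => i (s j)]).

(* (x, W) |-> l x^{(x) d} + W *)
Definition spike_plus_noise n d (l : R) (p : vec n * tensor n d) : tensor n d :=
  mktensor (fun i => l * \prod_(j < d) tnth p.1 (i j) + coef p.2 i).

Lemma measurable_mktensor dT (T : measurableType dT) n d
    (f : T -> {ffun 'I_d -> 'I_n} -> R) :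
  (forall i, measurable_fun setT (f ^~ i)) ->
  measurable_fun setT (fun x => mktensor (f x)).
Proof.
move=> mf; apply/measurable_fun_tnthP => k.
rewrite (_ : _ \o _ = f ^~ (enum_val k)) //.
by apply/funext => x /=; rewrite tnth_mktuple.
Qed.

Lemma measurable_symmetrize n d : measurable_fun setT (@symmetrize n d).
Proof.
apply: measurable_mktensor => i; apply: measurable_funM => //.
by apply: measurable_sum => s; exact: measurable_tnth.
Qed.

HB.instance Definition _ n d := isMeasurableFun.Build _ _ _ _
  (@symmetrize n d) (@measurable_symmetrize n d).

Lemma measurable_spike_plus_noise n d l :
  measurable_fun setT (@spike_plus_noise n d l).
Proof.
apply: measurable_mktensor => i; apply: measurable_funD.
  apply: measurable_funM => //.
  apply: measurable_prod => j _.
  by apply: (measurableT_comp (measurable_tnth _)); exact: measurable_fst.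
by apply: (measurableT_comp (measurable_tnth _)); exact: measurable_snd.
Qed.

HB.instance Definition _ n d l := isMeasurableFun.Build _ _ _ _
  (@spike_plus_noise n d l) (@measurable_spike_plus_noise n d l).

(* [normal_prob] is a measure on [measurableTypeR R], which carries the same
   sigma-algebra as [R] but under another display; the identity is used to
   transport it. *)
Definition id_R : measurableTypeR R -> R := idfun.

HB.instance Definition _ := isMeasurableFun.Build _ _ _ _
  id_R (@measurable_id _ _ setT).

(* the normal law with mean m and standard deviation s *)
Definition gaussian (m s : R) : probability R R :=
  distribution (normal_prob m s) id_R.

Lemma gaussianE m s (A : set R) : gaussian m s A = normal_prob m s A.
Proof. by []. Qed.

(* i.i.d. N(0, 2/n) entries *)
Definition iid_noise (n d : nat) : probability (tensor n d) R :=
  iid_law (gaussian 0 (Num.sqrt (2 / n%:R))) #|{ffun 'I_d -> 'I_n}|.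

Definition WT (n d : nat) : probability (tensor n d) R :=
  distribution (iid_noise n d) (@symmetrize n d).

Definition prior_family := forall n : nat, probability (vec n) R.

(* joint law of the independent pair (x, W) *)
Definition spike_noise_law (X : prior_family) (n d : nat)
  : probability (vec n * tensor n d)%type R := (X n \x WT n d)%E.

Definition spikedWT (X : prior_family) (l : R) (n d : nat)
  : probability (tensor n d) R :=
  distribution (spike_noise_law X n d) (@spike_plus_noise n d l).

(* A decision rule answers [true] for the spiked model; both hypotheses have
   probability 1/2. *)
Definition success_prob (X : prior_family) (l : R) (n d : nat)
    (phi : tensor n d -> bool) : \bar R :=
  ((2^-1)%:E * (spikedWT X l n d [set t | phi t] +
                WT n d [set t | ~~ phi t]))%E.

(* In the three notions below, N is the set of dimensions n over which the
   limit n -> oo is taken. *)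
Definition strong_detection (N : set nat) (X : prior_family) (l : R) (d : nat)
    : Prop :=
  exists phi : forall n, {mfun tensor n d >-> bool},
    success_prob X l (phi n) @[n --> within N \oo] --> 1%E.

Definition weak_detection (N : set nat) (X : prior_family) (l : R) (d : nat)
    : Prop :=
  exists2 eps : R, 0 < eps &
    exists phi : forall n, {mfun tensor n d >-> bool},
      \forall n \near within N \oo,
        ((2^-1 + eps)%:E <= success_prob X l (phi n))%E.

Definition weak_recovery (N : set nat) (X : prior_family) (l : R) (d : nat)
    : Prop :=
  exists2 eps : R, 0 < eps &
    exists2 xhat : forall n, {mfun tensor n d >-> vec n},
      (forall n, N n -> forall t, unit_vec (xhat n t)) &
      \forall n \near within N \oo,
        (eps%:E <= 'E_(spike_noise_law X n d)
          [(fun p => dot p.1 (xhat n (spike_plus_noise l p)) ^+ d)%R])%E.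

(* the dimensions n for which rho n is an integer *)
Definition sparse_dims (rho : R) : set nat :=
  [set n | (0 < n)%N /\ rho * n%:R \is a Num.nat].

Definition sparse_vec (rho : R) n (S : {set 'I_n}) (s : {ffun 'I_n -> bool})
    : vec n :=
  [tuple if i \in S then (-1) ^+ s i / Num.sqrt (rho * n%:R) else 0 | i < n].

(* The support S is uniform among the sets of exactly rho n coordinates. The
   signs are drawn on all the coordinates, those outside S being ignored: on S
   they are i.i.d. uniform. *)
Definition spRade (rho : R) : prior_family := fun n =>
  uniform_law (T := vec n) R [tuple 0 | _ < n]
    [seq sparse_vec rho p.1 p.2
       | p : {set 'I_n} * {ffun 'I_n -> bool} <- enum predT
       & #|p.1|%:R == rho * n%:R].

Lemma unit_sparse_vec (rho : R) n (S : {set 'I_n}) (s : {ffun 'I_n -> bool}) :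
  sparse_dims rho n -> 0 < rho -> #|S|%:R = rho * n%:R ->
  unit_vec (sparse_vec rho S s).
Proof.
move=> [n0 _] rho0 cS; have rn0 : 0 < rho * n%:R by rewrite mulr_gt0 ?ltr0n.
rewrite /unit_vec /dot (eq_bigr (fun i => if i \in S then (rho * n%:R)^-1 else 0)).
  by rewrite -big_mkcond /= sumr_const -[LHS]mulr_natr cS mulVf // gt_eqF.
move=> i _; rewrite tnth_mktuple; case: ifP => _; last by rewrite mul0r.
by rewrite mulrACA -expr2 sqrr_sign mul1r -invfM -expr2 sqr_sqrtr // ltW.
Qed.

Lemma spRade_unit (rho : R) n : 0 < rho <= 1 -> sparse_dims rho n ->
  spRade rho n [set x | unit_vec x] = 1%E.
Proof.
move=> /andP[rho0 rho1] dn; have [n0 /natrP[k rnk]] := dn.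
have kn : (k <= n)%N by rewrite -(ler_nat R) -rnk ler_piMl.
rewrite /spRade; set s := map _ _.
have s0 : (0 < size s)%N.
  pose S := finset (fun i : 'I_n => (i < k)%N).
  have cS : #|S| = k.
    rewrite -sum1_card (eq_bigl (fun i : 'I_n => (i < k)%N)); last by move=> i; rewrite inE.
    by rewrite -(big_ord_widen n (fun=> 1%N)) // sum_nat_const card_ord muln1.
  rewrite size_map size_filter -has_count; apply/hasP.
  exists (S, [ffun=> false]); first by rewrite mem_enum.
  by rewrite /= cS rnk.
rewrite uniform_lawE //; congr _%:E.
suff -> : count (mem [set x : vec n | unit_vec x]) s = size s.
  by rewrite divff // pnatr_eq0 -lt0n.
apply/eqP; rewrite -all_count; apply/allP => x /mapP[[S e]].
rewrite mem_filter => /andP[/eqP cS _] -> /=.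
by rewrite mem_set //=; exact: unit_sparse_vec.
Qed.

Definition binary_entropy (rho : R) : R :=
  - (rho * ln rho) - (1 - rho) * ln (1 - rho).

End tensors.

(* Main.v *)
From HB Require Import structures.
Require Import Defs.
From mathcomp Require Import all_boot all_order all_fingroup all_algebra.
From mathcomp Require Import all_classical all_reals all_analysis.
From mathcomp Require Import measurable_realfun.
From mathcomp Require Import ring lra.
Import Order.TTheory GRing.Theory Num.Theory.
Import numFieldNormedType.Exports.

(* Write H for the exponential rate H(rho) + rho log 2 of the number of spikes.
   Symmetrisation is linear and fixes x^{(x) d}, so a test or an estimator for
   the symmetric tensor is one for l x^{(x) d} + y with y of i.i.d. entries.
   Above 2 sqrt H, a union bound shows that the linear statistic <v^{(x) d}, T>
   exceeds 2 sqrt H + e for no spike v under pure noise, whereas it is about l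
   at the planted one; any v passing the test overlaps with the planted x.
   Below, the plain second moment E exp(n l^2 <x,x'>^d / 2) of the likelihood
   ratio only stays bounded up to sqrt (2 H). The likelihood ratio of the spike x
   is therefore restricted to the typical event <x^{(x) d}, T> <= l + eta, on
   which it is at most exp(n (l^2 / 4 + l eta / 2)). Pairs with <x,x'> near 1 or -1,
   of probability about exp(-n H), then contribute a vanishing amount as soon as
   l < 2 sqrt H, and for d large the other pairs are controlled by a Gaussian
   tail bound on <x,x'>. Hence the truncated second moment tends to 1, which
   excludes weak detection; the same sum weighted by |<x,x'>|^d tends to 0, which
   excludes weak recovery. It suffices to argue along the dimensions n0 q^4,
   q -> oo. *)

Local Open Scope classical_set_scope.
Local Open Scope ring_scope.

(** * Translates of Gaussian vectors *)

Section gaussian_shift.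
Context {R : realType}.
Local Open Scope ereal_scope.
Notation mu := (@lebesgue_measure R).

(** Both impossibility bounds use, instead of the Cauchy-Schwarz inequality for integrals, the
    pointwise inequality u v <= u^2 / (2 k) + k v^2 / 2, where [k] is finally the claimed advantage.
    Only integrals of nonnegative functions then occur, and no square root. Recovery is not reduced
    to detection: the estimate enters through its tensor power, paired with the mixture of the
    spikes weighted by truncated likelihood ratios, whose squared norm is the weighted second
    moment. The order of the choices explains why the threshold is only reached as d grows: the
    margin h - l1^2 / 4 fixes the slack eta, an exponential tilt a and the width tau of the range of
    near pairs; tau then dictates how large d must be for r^d to be negligible beside r^2 on
    [0, 1 - tau]. The fourth power in the dimensions comes from the cut t = 1 / q between small and
    intermediate overlaps: small ones require n t^d -> 0, the Gaussian tail requires n t^2 -> oo,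
    and n = n0 q^4 gives both for d >= 5 without leaving the integers. *)

Lemma ge0_integral_normal_prob (m s : R) (f : measurableTypeR R -> \bar R) :
  measurable_fun setT f -> (forall x, 0 <= f x) ->
  \int[normal_prob m s]_x f x = \int[mu]_x (f x * (normal_pdf m s x)%:E).
Proof.
move=> mf f0; have dom := @normal_prob_dominates R m s.
rewrite -(Radon_Nikodym_SigmaFinite.change_of_variables dom)//.
have mpdf : measurable_fun setT (fun x : measurableTypeR R => (normal_pdf m s x)%:E).
  by apply/measurable_EFinP; exact: measurable_normal_pdf.
have mRN : measurable_fun setT
    (Radon_Nikodym_SigmaFinite.f (normal_prob m s) mu).
  exact: measurable_int (Radon_Nikodym_SigmaFinite.f_integrable dom).
apply: ge0_ae_eq_integral => //=.
- exact: emeasurable_funM.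
- exact: emeasurable_funM.
- by move=> x _; rewrite mule_ge0 ?Radon_Nikodym_SigmaFinite.f_ge0.
- by move=> x _; rewrite mule_ge0// lee_fin normal_pdf_ge0.
- apply: ae_eqe_mul2l; apply: integral_ae_eq => //=.
    exact: Radon_Nikodym_SigmaFinite.f_integrable.
  by move=> E _ mE; rewrite -Radon_Nikodym_SigmaFinite.f_integral.
Qed.

Let shiftR (a : R) : measurableTypeR R -> measurableTypeR R := fun x => (a + x)%R.

Let measurable_shiftR (a : R) : measurable_fun setT (shiftR a).
Proof. by apply: measurable_funD => //; exact: measurable_cst. Qed.

Lemma lebesgue_measure_shift (a : R) (A : set (measurableTypeR R)) :
  measurable A -> pushforward mu (shiftR a) A = mu A.
Proof.
pose mixin := isMeasurableFun.Build _ _ _ _ _ (measurable_shiftR a).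
pose sh : {mfun _ >-> _} := HB.pack (shiftR a) mixin.
move=> mA; apply/esym.
apply: (@lebesgue_measure_unique R (pushforward mu sh)) => // _ [[b c]] _ <-.
rewrite [RHS](_ : _ = mu [set` `](b - a)%R, (c - a)%R]]); last first.
  congr (mu _).
  by apply/seteqP; split=> x /=; rewrite !in_itv/= ltrBlDl lerBrDl.
rewrite !lebesgue_measure_itv/= !lte_fin ltrD2r.
by case: ifP => // _; rewrite -EFinB; congr _%:E; ring.
Qed.

Lemma ge0_integral_lebesgue_shift (a : R) (f : measurableTypeR R -> \bar R) :
  measurable_fun setT f -> (forall x, 0 <= f x) ->
  \int[mu]_x f (a + x)%R = \int[mu]_x f x.
Proof.
move=> mf f0.
pose mixin := isMeasurableFun.Build _ _ _ _ _ (measurable_shiftR a).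
pose sh : {mfun _ >-> _} := HB.pack (shiftR a) mixin.
transitivity (\int[pushforward mu sh]_x f x).
  by rewrite ge0_integral_pushforward.
by apply: eq_measure_integral => A mA _; exact: lebesgue_measure_shift.
Qed.

Lemma ge0_integral_gaussian (m s : R) (f : R -> \bar R) :
  measurable_fun setT f -> (forall x, 0 <= f x) ->
  \int[gaussian m s]_x f x = \int[mu]_x (f x * (normal_pdf m s x)%:E).
Proof.
by move=> mf f0; rewrite ge0_integral_distribution//= ge0_integral_normal_prob.
Qed.

Lemma gaussian_shift (s a : R) (f : R -> \bar R) : (s != 0)%R ->
  measurable_fun setT f -> (forall x, 0 <= f x) ->
  \int[gaussian 0 s]_x f (a + x)%R =
  \int[gaussian 0 s]_x (f x * (expR ((a * x - a ^+ 2 / 2) / s ^+ 2))%:E).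
Proof.
move=> s0 mf f0; rewrite ge0_integral_gaussian//; last first.
  by apply: measurableT_comp => //; exact: measurable_funD.
rewrite ge0_integral_gaussian//; last 2 first.
- apply: emeasurable_funM => //; apply/measurable_EFinP.
  apply: measurableT_comp => //; apply: measurable_funM => //.
  by apply: measurable_funB => //; apply: measurable_funM.
- by move=> x; rewrite mule_ge0// lee_fin expR_ge0.
rewrite -(ge0_integral_lebesgue_shift (- a)); first last.
- by move=> x; rewrite mule_ge0// lee_fin normal_pdf_ge0.
- apply: emeasurable_funM.
    by apply: measurableT_comp => //; exact: measurable_funD.
  by apply/measurable_EFinP; exact: measurable_normal_pdf.
apply: eq_integral => x _; rewrite addrA subrr add0r -muleA -EFinM.
congr (_ * _%:E); rewrite !normal_pdfE//= mulrCA; congr (_ * _)%R.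
rewrite /normal_fun -expRD; congr expR.
by field.
Qed.

End gaussian_shift.

Section iid_gaussian.
Context {R : realType}.

Definition tadd k (a y : k.-tuple R) : k.-tuple R :=
  [tuple tnth a i + tnth y i | i < k].

Lemma measurable_tadd k (a : k.-tuple R) : measurable_fun setT (tadd k a).
Proof.
apply/measurable_fun_tnthP => i.
rewrite (_ : _ \o _ = fun y => tnth a i + tnth y i).
  by apply: measurable_funD => //; exact: measurable_tnth.
by apply/funext => y /=; rewrite tnth_mktuple.
Qed.

Lemma measurable_dot n (a : vec R n) : measurable_fun setT (dot a).
Proof.
apply: measurable_sum => i; apply: measurable_funM => //.
exact: measurable_tnth.
Qed.

Lemma dot_cons k (x y : R) (a b : k.-tuple R) :
  @dot R k.+1 [tuple of x :: a] [tuple of y :: b] = x * y + @dot R k a b.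
Proof.
rewrite /dot big_ord_recl !tnth0; congr (_ + _).
by apply: eq_bigr => i _; rewrite !tnthS.
Qed.

Lemma tadd_cons k (x y : R) (a b : k.-tuple R) :
  tadd k.+1 [tuple of x :: a] [tuple of y :: b] = [tuple of (x + y) :: tadd k a b].
Proof.
apply: eq_from_tnth => i; rewrite tnth_mktuple.
by case: (unliftP ord0 i) => [j|] ->; rewrite ?tnthS ?tnth0 ?tnth_mktuple.
Qed.

Local Open Scope ereal_scope.

Lemma ge0_integral_iidS (P : probability R R) k (f : k.+1.-tuple R -> \bar R) :
  measurable_fun setT f -> (forall x, 0 <= f x) ->
  \int[iid_law P k.+1]_y f y =
  \int[P]_x \int[iid_law P k]_y f [tuple of x :: y].
Proof.
move=> mf f0 /=; rewrite ge0_integral_distribution//.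
rewrite fubini_tonelli1//; last by move=> x; exact: f0.
  by apply: measurableT_comp => //; exact: measurable_cons_pair.
Qed.

Lemma measurable_gauss_weight (s : R) k (a : k.-tuple R) :
  measurable_fun setT
    (fun y : k.-tuple R => expR ((dot (n:=k) a y - dot (n:=k) a a / 2) / s ^+ 2)%R).
Proof.
apply: measurableT_comp => //; apply: measurable_funM => //.
by apply: measurable_funB => //; exact: measurable_dot.
Qed.

(** Cameron-Martin formula for the product law. The one-dimensional densities multiply and their
    exponents add up to the inner products, so induction peels off one coordinate at a time by
    Tonelli. *)
Lemma iid_gaussian_shift (s : R) k (a : k.-tuple R) (f : k.-tuple R -> \bar R) :
  (s != 0)%R -> measurable_fun setT f -> (forall x, 0 <= f x) ->
  \int[iid_law (gaussian 0 s) k]_y f (tadd k a y) =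
  \int[iid_law (gaussian 0 s) k]_y
    (f y * (expR ((dot (n:=k) a y - dot (n:=k) a a / 2) / s ^+ 2))%:E).
Proof.
move=> s0; elim: k a f => [|k IH] a f mf f0.
  have mw := measurable_gauss_weight s 0 a.
  rewrite /= !integral_dirac//; last 2 first.
  - by apply: emeasurable_funM => //; exact/measurable_EFinP.
  - by apply: measurableT_comp => //; exact: measurable_tadd.
  rewrite diracT !mul1e (tuple0 (tadd _ _ _)) /dot !big_ord0.
  by rewrite !(mul0r, subr0) expR0 mule1.
have mw := measurable_gauss_weight s k.+1 a.
have mft : measurable_fun setT (f \o tadd k.+1 a).
  by apply: measurableT_comp => //; exact: measurable_tadd.
rewrite !ge0_integral_iidS//; last 2 first.
- by apply: emeasurable_funM => //; exact/measurable_EFinP.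
- by move=> x; rewrite mule_ge0// lee_fin expR_ge0.
case/tupleP: a mw mft => a0 a mw mft.
have mc (x : R) : measurable_fun setT (fun y : k.-tuple R => [tuple of x :: y]).
  by apply: measurable_cons => //; exact: measurable_id.
under eq_integral do under eq_integral do rewrite tadd_cons.
under eq_integral => x _.
  rewrite (IH a (fun y => f [tuple of (a0 + x)%R :: y]))//; last first.
    by apply: measurableT_comp => //.
  over.
pose g x := \int[iid_law (gaussian 0 s) k]_y
   (f [tuple of x :: y] * (expR ((dot (n:=k) a y - dot (n:=k) a a / 2) / s ^+ 2))%:E).
have mfw : measurable_fun setT (fun p : R * k.-tuple R => f [tuple of p.1 :: p.2] *
    (expR ((dot (n:=k) a p.2 - dot (n:=k) a a / 2) / s ^+ 2))%:E).
  apply: emeasurable_funM.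
    by apply: measurableT_comp => //; exact: measurable_cons_pair.
  apply/measurable_EFinP.
  by apply: (measurableT_comp (measurable_gauss_weight s k a)).
have g0 x : 0 <= g x.
  by apply: integral_ge0 => y _; rewrite mule_ge0// lee_fin expR_ge0.
have mg : measurable_fun setT g.
  apply: (measurable_fun_fubini_tonelli_F (m2 := iid_law (gaussian 0 s) k) _ mfw).
  by move=> p; rewrite mule_ge0// lee_fin expR_ge0.
rewrite (gaussian_shift s a0 g)//.
apply: eq_integral => x _; rewrite -ge0_integralZr//; last 2 first.
- apply: emeasurable_funM; last by apply/measurable_EFinP; exact: measurable_gauss_weight.
  by apply: measurableT_comp.
- by move=> y _; rewrite mule_ge0// lee_fin expR_ge0.
apply: eq_integral => y _; rewrite -muleA -EFinM -expRD !dot_cons.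
by congr (_ * (expR _)%:E); field.
Qed.

End iid_gaussian.

(** * The second moment method with truncated likelihood ratios *)

Section second_moment.
Context {d} {T : measurableType d} {R : realType} (Q : probability T R).

(** For this class, expectations in the extended reals are additive and monotone with no
    integrability to check. *)
Definition ge0_mfun (f : T -> R) := measurable_fun setT f /\ forall y, 0 <= f y.

Lemma ge0_mfunD f g : ge0_mfun f -> ge0_mfun g -> ge0_mfun (fun y => f y + g y).
Proof.
by move=> [mf f0] [mg g0]; split=> [|y]; [exact: measurable_funD|exact: addr_ge0].
Qed.

Lemma ge0_mfunM f g : ge0_mfun f -> ge0_mfun g -> ge0_mfun (fun y => f y * g y).
Proof.
by move=> [mf f0] [mg g0]; split=> [|y]; [exact: measurable_funM|exact: mulr_ge0].
Qed.

Lemma ge0_mfun_cst c : 0 <= c -> ge0_mfun (fun=> c).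
Proof. by move=> c0; split. Qed.

Lemma ge0_mfun_sum (J : finType) (f : J -> T -> R) : (forall j, ge0_mfun (f j)) ->
  ge0_mfun (fun y => \sum_j f j y).
Proof.
move=> nf; split=> [|y]; first by apply: measurable_sum => j; case: (nf j).
by apply: sumr_ge0 => j _; case: (nf j).
Qed.

Lemma ge0_mfun_bool (b : T -> bool) : measurable_fun setT b -> ge0_mfun (fun y => (b y)%:R).
Proof.
move=> mb; split=> [|y]; last exact: ler0n.
rewrite (_ : (fun y => _) = (fun y => if b y then 1 else 0)).
  exact: measurable_fun_ifT.
by apply/funext => y; case: (b y).
Qed.

Local Open Scope ereal_scope.

Lemma ge0_expectD f g : ge0_mfun f -> ge0_mfun g ->
  \int[Q]_y (f y + g y)%:E = \int[Q]_y (f y)%:E + \int[Q]_y (g y)%:E.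
Proof.
move=> [mf f0] [mg g0]; under eq_integral do rewrite EFinD.
rewrite ge0_integralD//; try by move=> y _; rewrite lee_fin.
- exact/measurable_EFinP.
- exact/measurable_EFinP.
Qed.

Lemma ge0_expectZ c f : ge0_mfun f -> (0 <= c)%R ->
  \int[Q]_y (c * f y)%:E = c%:E * \int[Q]_y (f y)%:E.
Proof.
move=> [mf f0] c0; under eq_integral do rewrite EFinM.
rewrite ge0_integralZl//; last by move=> y _; rewrite lee_fin.
exact/measurable_EFinP.
Qed.

Lemma ge0_expect_sum (J : finType) (f : J -> T -> R) : (forall j, ge0_mfun (f j)) ->
  \int[Q]_y (\sum_j f j y)%:E = \sum_j \int[Q]_y (f j y)%:E.
Proof.
move=> nf; under eq_integral do rewrite -sumEFin.
rewrite ge0_integral_sum//.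
- by move=> j; apply/measurable_EFinP; case: (nf j).
- by move=> j y _; rewrite lee_fin; case: (nf j).
Qed.

Lemma le_expect f g : ge0_mfun f -> ge0_mfun g -> (forall y, f y <= g y)%R ->
  \int[Q]_y (f y)%:E <= \int[Q]_y (g y)%:E.
Proof.
move=> [mf f0] [mg g0] fg; apply: ge0_le_integral => //.
- by move=> y _; rewrite lee_fin.
- exact/measurable_EFinP.
- exact/measurable_EFinP.
- by move=> y _; rewrite lee_fin.
Qed.

Lemma expect_cst c : \int[Q]_y c%:E = c%:E.
Proof. by rewrite integral_cst// [X in _ * X]probability_setT mule1. Qed.

(** In the application [w j] is the likelihood ratio of the spike [j], [G j] its typical event,
    [eps] the planted probability of leaving that event, and [M] bounds the truncated
    correlations. *)
Context {J : finType} (w : J -> T -> R) (G : J -> T -> bool).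
Context (eps : R) (M : J -> J -> R).
Hypothesis J0 : (0 < #|J|)%N.
Hypothesis nw : forall j, ge0_mfun (w j).
Hypothesis mG : forall j, measurable_fun setT (G j).
Hypothesis w1 : forall j, \int[Q]_y (w j y)%:E = 1.
Hypothesis w_bad : forall j, \int[Q]_y (w j y * (~~ G j y)%:R)%:E <= eps%:E.
Hypothesis w_good : forall i j,
  \int[Q]_y ((w i y * (G i y)%:R) * (w j y * (G j y)%:R))%:E <= (M i j)%:E.

Let N : R := (#|J|%:R)^-1.
Let N0 : (0 < N)%R. Proof. by rewrite invr_gt0 ltr0n. Qed.

Let NJ (c : R) : (N * \sum_(j : J) c = c)%R.
Proof.
by rewrite sumr_const -[X in (_ * X)%R]mulr_natl mulrA mulVf ?mul1r// pnatr_eq0 -lt0n.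
Qed.

Let t j y := (w j y * (G j y)%:R)%R.
Let nt j : ge0_mfun (t j).
Proof. by apply: ge0_mfunM => //; exact: ge0_mfun_bool. Qed.

Let mnG j : measurable_fun setT (fun y => ~~ G j y).
Proof. exact: measurable_neg. Qed.

Let nb j : ge0_mfun (fun y => w j y * (~~ G j y)%:R)%R.
Proof. by apply: ge0_mfunM => //; apply: ge0_mfun_bool. Qed.

Let wtb j y : w j y = (t j y + w j y * (~~ G j y)%:R)%R.
Proof. by rewrite /t; case: (G j y); rewrite ?(mulr1,mulr0,addr0,add0r). Qed.

Let t_bnd j : (1 - eps)%:E <= \int[Q]_y (t j y)%:E <= 1.
Proof.
have E : \int[Q]_y (t j y)%:E + \int[Q]_y (w j y * (~~ G j y)%:R)%:E = 1.
  by rewrite -ge0_expectD// -(w1 j); apply: eq_integral => y _; rewrite -wtb.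
apply/andP; split.
  rewrite EFinB leeBlDr// -E leeD2l//; exact: w_bad.
rewrite -E leeDl//; apply: integral_ge0 => y _; rewrite lee_fin.
by case: (nb j).
Qed.

(** The truncated likelihood ratio of the mixture: a density up to a missing mass of at most
    [eps]. *)
Let L y := (N * \sum_j t j y)%R.
Let nL : ge0_mfun L.
Proof. by apply: ge0_mfunM; [apply: ge0_mfun_cst; exact: ltW|exact: ge0_mfun_sum]. Qed.

Let expL : (1 - eps)%:E <= \int[Q]_y (L y)%:E <= 1.
Proof.
rewrite /L ge0_expectZ ?(ltW N0)//; last exact: ge0_mfun_sum.
rewrite ge0_expect_sum//; apply/andP; split.
  rewrite -(NJ (1 - eps)) EFinM lee_pmul2l// -sumEFin.
  by apply: lee_sum => j _; case/andP: (t_bnd j).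
rewrite -[X in _ <= X]/(1%R%:E) -(NJ 1) EFinM lee_pmul2l// -sumEFin.
by apply: lee_sum => j _; case/andP: (t_bnd j).
Qed.

Let expLL (c : J -> J -> R) : (forall i j, 0 <= c i j)%R ->
  \int[Q]_y (N ^+ 2 * \sum_i \sum_j c i j * (t i y * t j y))%:E <=
  (N ^+ 2 * \sum_i \sum_j c i j * M i j)%:E.
Proof.
move=> c0; have n1 i j : ge0_mfun (fun y => c i j * (t i y * t j y))%R.
  by apply: ge0_mfunM; [exact: ge0_mfun_cst|exact: ge0_mfunM].
have n2 i : ge0_mfun (fun y => \sum_j c i j * (t i y * t j y))%R by exact: ge0_mfun_sum.
rewrite ge0_expectZ ?sqr_ge0//; last exact: ge0_mfun_sum.
rewrite (EFinM (N ^+ 2)) lee_pmul2l ?lte_fin ?exprn_gt0// ge0_expect_sum// -sumEFin.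
apply: lee_sum => i _; rewrite ge0_expect_sum// -sumEFin; apply: lee_sum => j _.
rewrite ge0_expectZ//; last exact: ge0_mfunM.
by rewrite EFinM lee_wpmul2l ?lee_fin//; exact: w_good.
Qed.

Let ge0_fin (X : \bar R) (r : R) : 0 <= X -> X <= r%:E ->
  exists2 x, X = x%:E & (0 <= x <= r)%R.
Proof.
by case: X => [x||]//; rewrite !lee_fin => x0 xr; exists x; rewrite // x0 xr.
Qed.

Let exp_ge0 f : ge0_mfun f -> 0 <= \int[Q]_y (f y)%:E.
Proof. by move=> [_ f0]; apply: integral_ge0 => y _; rewrite lee_fin. Qed.

(** Replacing every weight by its truncation costs at most [B * eps], uniformly over test functions
    with values in [0, B]. *)
Let truncate (g : J -> T -> R) (B : R) : (0 <= B)%R ->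
  (forall j, ge0_mfun (g j)) -> (forall j y, g j y <= B)%R ->
  N%:E * (\sum_j \int[Q]_y (g j y * w j y)%:E) <=
  \int[Q]_y (N * \sum_j g j y * t j y)%:E + (B * eps)%:E.
Proof.
move=> B0 ng gB.
have ngt j : ge0_mfun (fun y => g j y * t j y)%R by exact: ge0_mfunM.
rewrite ge0_expectZ ?(ltW N0)//; last exact: ge0_mfun_sum.
rewrite ge0_expect_sum// -(NJ (B * eps)) EFinM -sumEFin -ge0_muleDr; last 2 first.
- by apply: sume_ge0 => j _; exact: exp_ge0.
- apply: sume_ge0 => j _; rewrite lee_fin mulr_ge0// -lee_fin.
  by apply: le_trans (w_bad j); exact: exp_ge0.
rewrite lee_pmul2l// -big_split/=; apply: lee_sum => j _.
have -> : \int[Q]_y (g j y * w j y)%:E = \int[Q]_y (g j y * t j y)%:E +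
    \int[Q]_y (g j y * (w j y * (~~ G j y)%:R))%:E.
  rewrite -ge0_expectD//; last exact: ge0_mfunM.
  by apply: eq_integral => y _; rewrite {1}wtb mulrDr.
rewrite leeD2l// EFinM.
apply: (@le_trans _ _ (B%:E * \int[Q]_y (w j y * (~~ G j y)%:R)%:E)).
  rewrite -ge0_expectZ//; apply: le_expect.
  - exact: ge0_mfunM.
  - by apply: ge0_mfunM => //; exact: ge0_mfun_cst.
  - by move=> y; apply: ler_wpM2r => //; case: (nb j).
by apply: lee_wpmul2l => //; rewrite lee_fin.
Qed.

(** For a test phi, phi (L - 1) <= (L - 1)^2 / (2 k) + k / 2 pointwise. Expanding the square leaves
    E L^2, bounded through [M], and E L, at least 1 - eps; this is the origin of [eps / k], while
    the lone [eps] pays for the truncation. *)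
Lemma second_moment_test (phi : T -> bool) (k : R) : measurable_fun setT phi ->
  (0 < k)%R ->
  N%:E * (\sum_j \int[Q]_y ((phi y)%:R * w j y)%:E) <=
  \int[Q]_y (phi y)%:R%:E +
  (eps + eps / k + (N ^+ 2 * (\sum_i \sum_j M i j) - 1) / (2 * k) + k / 2)%:E.
Proof.
move=> mphi k0; have nphi := ge0_mfun_bool phi mphi.
have kV : (0 <= k^-1)%R by rewrite invr_ge0 ltW.
have kV2 : (0 <= (2 * k)^-1)%R by rewrite invr_ge0 mulr_ge0// ltW.
have nphiL : ge0_mfun (fun y => (phi y)%:R * L y)%R by exact: ge0_mfunM.
have nkL : ge0_mfun (fun y => k^-1 * L y)%R by apply: ge0_mfunM => //; exact: ge0_mfun_cst.
have nLL : ge0_mfun (fun y => (2 * k)^-1 * (L y * L y))%R.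
  by apply: ge0_mfunM; [exact: ge0_mfun_cst|exact: ge0_mfunM].
have C0 : (0 <= (2 * k)^-1 + k / 2)%R by rewrite addr_ge0// divr_ge0// ltW.
apply: le_trans (truncate (fun=> fun y => (phi y)%:R) 1%R ler01 (fun=> nphi) _) _.
  by move=> _ y; case: (phi y).
rewrite mul1r; under eq_integral do rewrite -mulr_sumr mulrCA -/(L _).
have LLE y : (L y * L y = N ^+ 2 * \sum_i \sum_j 1 * (t i y * t j y))%R.
  rewrite /L mulrACA -expr2; congr (_ * _)%R; rewrite mulr_suml.
  apply: eq_bigr => i _; rewrite mulr_sumr; apply: eq_bigr => j _.
  by rewrite mul1r.
have : \int[Q]_y (L y * L y)%:E <= (N ^+ 2 * \sum_i \sum_j M i j)%:E.
  under eq_integral do rewrite LLE.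
  apply: le_trans (expLL (fun _ _ => 1%R) (fun _ _ => ler01)) _.
  by under eq_bigr do under eq_bigr do rewrite mul1r.
move=> /(ge0_fin _ _ (exp_ge0 _ (ge0_mfunM _ _ nL nL)))[e eE /andP[e0 eD]].
have [/= b bE /andP[b0 b1]] : exists2 b, \int[Q]_y (L y)%:E = b%:E & (0 <= b <= 1)%R.
  by case/andP: expL => _ /(ge0_fin _ _ (exp_ge0 _ nL)).
have [/= c cE /andP[c0 c1]] : exists2 c, \int[Q]_y (phi y)%:R%:E = c%:E & (0 <= c <= 1)%R.
  apply: ge0_fin; first exact: exp_ge0.
  rewrite -(expect_cst 1); apply: le_expect => //; last by move=> y; case: (phi y).
have [/= a aE /andP[a0 a1]] : exists2 a, \int[Q]_y ((phi y)%:R * L y)%:E = a%:E & (0 <= a <= 1)%R.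
  apply: ge0_fin; first exact: exp_ge0.
  case/andP: expL => _; apply: le_trans; apply: le_expect => //.
  by move=> y; case: (phi y); rewrite ?mul1r ?mul0r//; case: nL.
(* The negative terms of the expanded inequality are moved to the other side, so that both
   integrands are nonnegative. *)
have : \int[Q]_y ((phi y)%:R * L y + k^-1 * L y)%:E <=
    \int[Q]_y ((phi y)%:R + ((2 * k)^-1 * (L y * L y) + ((2 * k)^-1 + k / 2)))%:E.
  apply: le_expect; [exact: ge0_mfunD|by do 2 apply: ge0_mfunD => //; exact: ge0_mfun_cst|].
  move=> y; set p : R := (phi y)%:R; set l := L y.
  have p2 : (p * p = p)%R by rewrite /p; case: (phi y); rewrite ?mulr1 ?mulr0.
  have p1 : (0 <= 1 - p)%R by rewrite /p; case: (phi y); rewrite ?subrr ?subr0.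
  have kk : (k != 0)%R by rewrite gt_eqF.
  rewrite -subr_ge0.
  rewrite [leRHS](_ : _ = (2 * k)^-1 * ((l - 1) - k * p) ^+ 2 + k / 2 * (1 - p * p))%R.
    by rewrite p2 addr_ge0// mulr_ge0 ?sqr_ge0// divr_ge0// ltW.
  by field.
rewrite ge0_expectD// (ge0_expectZ (k^-1)%R L)// ge0_expectD//; last first.
  by apply: ge0_mfunD => //; exact: ge0_mfun_cst.
rewrite ge0_expectD//.
rewrite (ge0_expectZ ((2 * k)^-1)%R (fun y => L y * L y)%R)//; last exact: ge0_mfunM.
rewrite expect_cst aE bE cE eE -!EFinM -!EFinD !lee_fin.
have : (1 - eps <= b)%R by case/andP: expL; rewrite bE lee_fin.
move: (N ^+ 2 * _)%R eD => D eD.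
rewrite invfM; move: (k^-1)%R kV => h h0 b2 main.
have := ler_wpM2l h0 b2; have := ler_wpM2l h0 eD; lra.
Qed.

(** Exchanging sums turns the average overlap into the inner product of [b y] with A = N sum_j t_j
    v_j, and <A, b> <= |A|^2 / (2 k) + k / 2 since [b y] is a unit vector. The expectation of |A|^2
    is the overlap-weighted second moment. The added 1 keeps the integrand in [0, 2]. *)
Lemma second_moment_overlap m (v : J -> m.-tuple R) (b : T -> m.-tuple R) (k : R) :
  (forall i, measurable_fun setT (fun y => tnth (b y) i)) ->
  (forall y, \sum_i tnth (b y) i ^+ 2 = 1)%R ->
  (forall j, \sum_i tnth (v j) i ^+ 2 = 1)%R ->
  (0 < k)%R ->
  N%:E * (\sum_j \int[Q]_y ((1 + \sum_i tnth (v j) i * tnth (b y) i) * w j y)%:E) <=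
  (1 + 2 * eps + (N ^+ 2 * (\sum_i \sum_j
     `|\sum_l tnth (v i) l * tnth (v j) l| * M i j)) / (2 * k) + k / 2)%:E.
Proof.
move=> mb b1 v1 k0.
have kV2 : (0 <= (2 * k)^-1)%R by rewrite invr_ge0 mulr_ge0// ltW.
pose ip (j : J) y := (\sum_i tnth (v j) i * tnth (b y) i)%R.
have amgm j y (e : R) : (e ^+ 2 = 1)%R -> (e * ip j y <= 1)%R.
  move=> e1; have -> : (1 = \sum_i (tnth (v j) i ^+ 2 + tnth (b y) i ^+ 2) / 2)%R.
    by rewrite -mulr_suml big_split/= v1 b1; field.
  rewrite mulr_sumr; apply: ler_sum => i _.
  rewrite -subr_ge0 (_ : _ - _ = (e * tnth (v j) i - tnth (b y) i) ^+ 2 / 2)%R.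
    by rewrite divr_ge0 ?sqr_ge0.
  by rewrite sqrrB exprMn e1; field.
have ng j : ge0_mfun (fun y => 1 + ip j y)%R.
  split=> [|y]; last by have := amgm j y (-1)%R; rewrite sqrrN expr1n; lra.
  apply: measurable_funD => //; apply: measurable_sum => i.
  exact: measurable_funM.
have gB j y : (1 + ip j y <= 2)%R.
  by have := amgm j y 1%R; rewrite expr1n mul1r => /(_ erefl); lra.
have two : (0 <= 2 :> R)%R by [].
apply: le_trans (truncate (fun j y => 1 + ip j y)%R 2%R two ng gB) _.
pose ov i j := (`|\sum_l tnth (v i) l * tnth (v j) l|)%R.
(* Absolute overlaps make all coefficients nonnegative, so that the bounds [M] apply term by term; V
   dominates |A|^2. *)
pose V y := (N ^+ 2 * \sum_i \sum_j ov i j * (t i y * t j y))%R.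
have nV : ge0_mfun V.
  apply: ge0_mfunM; first by apply: ge0_mfun_cst; exact: sqr_ge0.
  apply: ge0_mfun_sum => i; apply: ge0_mfun_sum => j; apply: ge0_mfunM; last exact: ge0_mfunM.
  by apply: ge0_mfun_cst; exact: normr_ge0.
have nkV : ge0_mfun (fun y => (2 * k)^-1 * V y)%R by apply: ge0_mfunM => //; exact: ge0_mfun_cst.
have k20 : (0 <= k / 2)%R by rewrite divr_ge0// ltW.
have nB : ge0_mfun (fun y => L y + ((2 * k)^-1 * V y + k / 2))%R.
  by apply: ge0_mfunD => //; apply: ge0_mfunD => //; exact: ge0_mfun_cst.
apply: (@le_trans _ _ (\int[Q]_y (L y + ((2 * k)^-1 * V y + k / 2))%:E + (2 * eps)%:E)).
  rewrite leeD2r//; apply: le_expect => //.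
    apply: ge0_mfunM; first by apply: ge0_mfun_cst; exact: ltW.
    by apply: ge0_mfun_sum => j; exact: ge0_mfunM.
  move=> y; pose A l := (N * \sum_j t j y * tnth (v j) l)%R.
  have -> : (N * \sum_j (1 + ip j y) * t j y = L y + \sum_l A l * tnth (b y) l)%R.
    rewrite /L -[X in (_ + X)%R](_ : N * \sum_l \sum_j t j y * tnth (v j) l * tnth (b y) l = _)%R.
      rewrite -mulrDr exchange_big/= -big_split/=; congr (_ * _)%R.
      apply: eq_bigr => j _; rewrite mulrDl mul1r; congr (_ + _)%R.
      by rewrite /ip mulr_suml; apply: eq_bigr => l _; ring.
    rewrite mulr_sumr; apply: eq_bigr => l _.
    by rewrite /A -mulrA mulr_suml.
  rewrite lerD2l.
  have AV : (\sum_l A l ^+ 2 <= V y)%R.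
    have -> : (\sum_l A l ^+ 2 = N ^+ 2 * \sum_i \sum_j
        (\sum_l tnth (v i) l * tnth (v j) l) * (t i y * t j y))%R.
      under eq_bigr do rewrite /A exprMn.
      rewrite -mulr_sumr; congr (_ * _)%R.
      under eq_bigr do rewrite expr2 mulr_suml.
      rewrite exchange_big/=; apply: eq_bigr => i _.
      under eq_bigr do rewrite mulr_sumr.
      rewrite exchange_big/=; apply: eq_bigr => j _.
      by rewrite mulr_suml; apply: eq_bigr => l _; ring.
    rewrite ler_wpM2l ?sqr_ge0//; apply: ler_sum => i _; apply: ler_sum => j _.
    by apply: ler_wpM2r; [case: (ge0_mfunM _ _ (nt i) (nt j))|exact: ler_norm].
  apply: (@le_trans _ _ ((2 * k)^-1 * (\sum_l A l ^+ 2) + k / 2)%R); last first.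
    by rewrite lerD2r ler_wpM2l.
  have -> : (k / 2 = \sum_l k / 2 * tnth (b y) l ^+ 2)%R.
    by rewrite -mulr_sumr b1 mulr1.
  rewrite mulr_sumr -big_split/=.
  apply: ler_sum => l _; rewrite -subr_ge0.
  rewrite (_ : _ - _ = (2 * k)^-1 * (A l - k * tnth (b y) l) ^+ 2)%R.
    by rewrite mulr_ge0// sqr_ge0.
  by field; rewrite gt_eqF.
have nkV2 : ge0_mfun (fun y => (2 * k)^-1 * V y + k / 2)%R.
  by apply: ge0_mfunD => //; exact: ge0_mfun_cst.
rewrite ge0_expectD// ge0_expectD; [|exact: nkV|exact: ge0_mfun_cst].
rewrite (ge0_expectZ ((2 * k)^-1)%R V)// expect_cst.
have /(ge0_fin _ _ (exp_ge0 _ nV))[e -> /andP[e0 eD]] := expLL ov (fun i j => normr_ge0 _).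
have /andP[_ /(ge0_fin _ _ (exp_ge0 _ nL))[l -> /andP[l0 l1]]] := expL.
rewrite -EFinM -!EFinD lee_fin.
have := ler_wpM2l kV2 eD; rewrite [X in (_ <= X)%R]mulrC /ov; lra.
Qed.

End second_moment.

(** * Spiked tensors *)

Section tensor_model.
Context {R : realType} {n d : nat}.
Implicit Types (x : vec R n) (a b y : tensor R n d).

Definition tdot a b : R := dot (n := #|{ffun 'I_d -> 'I_n}|) a b.

Definition tpow x : tensor R n d := mktensor (fun i => \prod_(j < d) tnth x (i j)).

Lemma tdotE a b : tdot a b = \sum_i coef a i * coef b i.
Proof.
rewrite /tdot /dot (reindex (@enum_rank {ffun 'I_d -> 'I_n})) //=.
exact/onW_bij/enum_rank_bij.
Qed.

Lemma tdot_tpow x x' : tdot (tpow x) (tpow x') = dot x x' ^+ d.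
Proof.
rewrite tdotE /dot -[d in RHS]card_ord -prodr_const bigA_distr_bigA /=.
apply: eq_bigr => f _; rewrite !coef_mktensor -big_split/=.
by apply: eq_bigl => j.
Qed.

Lemma measurable_tdot a : measurable_fun setT (tdot a).
Proof. exact: measurable_dot. Qed.

Lemma tdot_spike a l x y :
  tdot a (spike_plus_noise l (x, y)) = l * tdot a (tpow x) + tdot a y.
Proof.
rewrite !tdotE mulr_sumr -big_split/=; apply: eq_bigr => i _.
by rewrite !coef_mktensor/=; ring.
Qed.

Lemma tdot_symmetrize x y : tdot (tpow x) (symmetrize y) = tdot (tpow x) y.
Proof.
rewrite !tdotE.
under eq_bigr do rewrite [coef (symmetrize y) _]coef_mktensor mulrCA mulr_sumr.
rewrite -mulr_sumr exchange_big/=.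
have E (s : {perm 'I_d}) :
    \sum_i coef (tpow x) i * coef y [ffun j => i (s j)] =
    \sum_i coef (tpow x) i * coef y i.
  rewrite (reindex (fun f : {ffun 'I_d -> 'I_n} => [ffun j => f ((s^-1)%g j)]))/=.
    apply: eq_bigr => f _; rewrite !coef_mktensor; congr (_ * coef y _).
      rewrite [RHS](reindex_inj (perm_inj (s := (s^-1)%g)))/=.
      by apply: eq_bigr => j _; rewrite ffunE.
    by apply/ffunP => j; rewrite !ffunE permK.
  exists (fun f : {ffun 'I_d -> 'I_n} => [ffun j => f (s j)]) => f _.
    by apply/ffunP => j; rewrite !ffunE permK.
  by apply/ffunP => j; rewrite !ffunE permKV.
under eq_bigr do rewrite E.
rewrite sumr_const -[#|_|]/#|{perm 'I_d}| card_Sn -[X in _ * X]mulr_natl mulrA.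
by rewrite mulVf ?mul1r// pnatr_eq0 -lt0n fact_gt0.
Qed.

Lemma symmetrize_spike l x y :
  symmetrize (spike_plus_noise l (x, y)) = spike_plus_noise l (x, symmetrize y).
Proof.
rewrite {1}/symmetrize [RHS]/spike_plus_noise; congr mktensor; apply/funext => i.
rewrite coef_mktensor.
have E (s : {perm 'I_d}) : coef (spike_plus_noise l (x, y)) [ffun j => i (s j)] =
    l * \prod_(j < d) tnth x (i j) + coef y [ffun j => i (s j)].
  rewrite coef_mktensor/=; congr (_ * _ + _).
  rewrite [RHS](reindex_inj (perm_inj (s := s)))/=.
  by apply: eq_bigr => j _; rewrite ffunE.
under eq_bigr do rewrite E.
rewrite big_split/= mulrDr sumr_const -[#|_|]/#|{perm 'I_d}| card_Sn.
by rewrite -(mulr_natl (l * _)) mulKf// pnatr_eq0 -lt0n fact_gt0.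
Qed.

Lemma spike_tadd l x y : spike_plus_noise l (x, y) =
  tadd _ (mktensor (fun i => l * \prod_(j < d) tnth x (i j)) : tensor R n d) y.
Proof.
by apply: eq_from_tnth => k; rewrite !tnth_mktuple/= /coef enum_valK.
Qed.

(* The density of l x^{(x) d} + noise with respect to the noise, for a unit vector x. *)
Definition lik l x y : R := expR (n%:R / 2 * (l * tdot (tpow x) y - l ^+ 2 / 2)).

Lemma measurable_lik l x : measurable_fun setT (lik l x).
Proof.
apply: measurableT_comp => //; apply: measurable_funM => //.
apply: measurable_funB => //; apply: measurable_funM => //.
exact: measurable_tdot.
Qed.

Lemma ge0_mfun_lik l x : ge0_mfun (lik l x).
Proof. by split; [exact: measurable_lik|move=> y; exact: expR_ge0]. Qed.

Hypothesis n0 : (0 < n)%N.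

Local Open Scope ereal_scope.
Notation Q := (iid_noise R n d).

Lemma integral_spike l x (f : tensor R n d -> \bar R) : unit_vec x ->
  measurable_fun setT f -> (forall y, 0 <= f y) ->
  \int[Q]_y f (spike_plus_noise l (x, y)) = \int[Q]_y (f y * (lik l x y)%:E).
Proof.
move=> ux mf f0; under eq_integral do rewrite spike_tadd.
have n0R : (0 < n%:R :> R)%R by rewrite ltr0n.
have s2 : (Num.sqrt (2 / n%:R) ^+ 2 = 2 / n%:R :> R)%R.
  by rewrite sqr_sqrtr// divr_ge0.
have s0 : (Num.sqrt (2 / n%:R) != 0 :> R)%R.
  by rewrite gt_eqF// sqrtr_gt0 divr_gt0.
rewrite /iid_noise iid_gaussian_shift//.
apply: eq_integral => y _; rewrite /lik s2; set a := mktensor _.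
have aE b : dot (n := #|{ffun 'I_d -> 'I_n}|) a b = (l * tdot (tpow x) b)%R.
  rewrite -[LHS]/(tdot a b) !tdotE mulr_sumr; apply: eq_bigr => i _.
  by rewrite !coef_mktensor; ring.
rewrite aE -[dot a a]/(tdot a a) [in tdot a a]/tdot aE.
have -> : tdot (tpow x) a = (l * tdot (tpow x) (tpow x))%R.
  rewrite !tdotE mulr_sumr; apply: eq_bigr => i _.
  by rewrite !coef_mktensor; ring.
rewrite tdot_tpow ux expr1n; congr (_ * (expR _)%:E).
by field; rewrite gt_eqF.
Qed.

Lemma integral_lik l x : unit_vec x -> \int[Q]_y (lik l x y)%:E = 1.
Proof.
move=> ux; rewrite -(expect_cst Q 1%R) (integral_spike l x (cst 1))//.
by apply: eq_integral => y _; rewrite mul1e.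
Qed.

(** One ratio is absorbed as a change of measure to the law spiked at [x]. There the exponent of
    [lik l x'] is shifted by a constant, and the remaining ratio integrates to 1. *)
Lemma integral_lik2 l x x' : unit_vec x -> unit_vec x' ->
  \int[Q]_y (lik l x y * lik l x' y)%:E =
  (expR (n%:R / 2 * (l ^+ 2 * dot x x' ^+ d)))%:E.
Proof.
move=> ux ux'; under eq_integral do rewrite mulrC EFinM.
rewrite -(integral_spike l x (fun y => (lik l x' y)%:E))//; last 2 first.
- by apply/measurable_EFinP; exact: measurable_lik.
- by move=> y; rewrite lee_fin expR_ge0.
transitivity (\int[Q]_y (expR (n%:R / 2 * (l ^+ 2 * dot x x' ^+ d)) * lik l x' y)%:E).
  apply: eq_integral => y _; rewrite /lik tdot_spike tdot_tpow -expRD.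
  rewrite (_ : dot x' x = dot x x'); last first.
    by apply: eq_bigr => i _; rewrite mulrC.
  by congr (expR _)%:E; field.
rewrite ge0_expectZ ?expR_ge0 ?integral_lik ?mule1//; exact: ge0_mfun_lik.
Qed.

(** Chernoff bound with the likelihood ratio itself as exponential weight: on the event, [lik c x]
    is at least exp(n c^2 / 4), and it has mean 1. Keeping the factor [c] on both sides covers the
    upper tail (c > 0) and the lower tail (c < 0) at once. *)
Lemma noise_tail c x : unit_vec x ->
  \int[Q]_y (c ^+ 2 <= c * tdot (tpow x) y)%R%:R%:E <=
  (expR (- (n%:R * c ^+ 2 / 4)))%:E.
Proof.
move=> ux.
apply: (@le_trans _ _ (\int[Q]_y (expR (- (n%:R * c ^+ 2 / 4)) * lik c x y)%:E)).
  apply: le_expect.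
  - apply: ge0_mfun_bool; apply: measurable_fun_ler => //.
    by apply: measurable_funM => //; exact: measurable_tdot.
  - by apply: ge0_mfunM; [apply: ge0_mfun_cst; exact: expR_ge0|exact: ge0_mfun_lik].
  - move=> y; rewrite /lik -expRD; case: (leP (c ^+ 2)%R) => [h|_]; last by rewrite /= expR_ge0.
    rewrite /= -[leLHS]expR0 ler_expR.
    rewrite (_ : _ + _ = n%:R / 2 * (c * tdot (tpow x) y - c ^+ 2))%R; last by field.
    by rewrite mulr_ge0 ?divr_ge0// subr_ge0.
by rewrite ge0_expectZ ?expR_ge0 ?integral_lik ?mule1//; exact: ge0_mfun_lik.
Qed.

End tensor_model.

(** * Reduction to the unsymmetrised noise *)

Section uniform.
Context {d} {T : measurableType d} {R : realType}.
Local Open Scope ereal_scope.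

Lemma ge0_integral_uniform_law (z : T) (s : seq T) (f : T -> \bar R) :
  (0 < size s)%N -> measurable_fun setT f -> (forall x, 0 <= f x) ->
  \int[uniform_law R z s]_x f x =
  ((size s)%:R^-1)%:E * \sum_(j < size s) f (nth z s j).
Proof.
move=> s0 mf f0; pose m := msum (fun i => \d_(nth z s i)) (size s) : {measure set T -> \bar R}.
have N0 : (0 <= (size s)%:R^-1 :> R)%R by rewrite invr_ge0.
have mT : m setT = (size s)%:R%:E.
  transitivity (\sum_(j < size s) (1%R : R)%:E); last by rewrite sumEFin sumr_const card_ord.
  by apply: eq_bigr => j _; exact: diracT.
transitivity (\int[mscale (NngNum N0) m]_x f x).
  apply: eq_measure_integral => A mA _.
  rewrite /uniform_law /= /mnormalize -/(m setT) mT eqe pnatr_eq0 -leqn0 leqNgt s0 /=.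
  by rewrite /mscale muleC.
rewrite ge0_integral_mscale//= ge0_integral_measure_sum//; congr (_ * _).
by apply: eq_bigr => i _; rewrite integral_dirac// diracT mul1e.
Qed.

Lemma prob_bool (P : probability T R) (phi : T -> bool) :
  measurable_fun setT phi ->
  P [set t | phi t] = \int[P]_t ((phi t)%:R)%:E.
Proof.
move=> mphi; have mA : measurable [set t | phi t].
  by rewrite -[X in measurable X]setTI; exact: mphi.
rewrite -[in LHS](setIT [set t | phi t]) -integral_indic//; apply: eq_integral => t _.
rewrite indicE; case: (boolP (phi t)) => pt.
  by rewrite mem_set.
by rewrite memNset//; exact/negP.
Qed.

End uniform.

Section model.
Context {R : realType} {n d : nat} (z : vec R n) (s : seq (vec R n)).
Context (X : prior_family R).
Hypothesis Xn : X n = uniform_law R z s.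
Hypothesis n0 : (0 < n)%N.
Hypothesis s0 : (0 < size s)%N.
Hypothesis us : forall j : 'I_(size s), unit_vec (nth z s j).

Local Open Scope ereal_scope.
Notation Q := (iid_noise R n d).
Notation J := 'I_(size s).
Let N : R := ((size s)%:R^-1)%R.

Lemma ge0_integral_WT (f : tensor R n d -> \bar R) :
  measurable_fun setT f -> (forall y, 0 <= f y) ->
  \int[WT R n d]_y f y = \int[Q]_y f (symmetrize y).
Proof. by move=> mf f0; rewrite ge0_integral_distribution. Qed.

Lemma ge0_integral_spike_noise (f : vec R n * tensor R n d -> \bar R) :
  measurable_fun setT f -> (forall y, 0 <= f y) ->
  \int[spike_noise_law X n d]_p f p =
  N%:E * \sum_(j : J) \int[Q]_y f (nth z s j, symmetrize y).
Proof.
move=> mf f0; rewrite /spike_noise_law fubini_tonelli1// Xn.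
rewrite ge0_integral_uniform_law//; last 2 first.
- exact: measurable_fun_fubini_tonelli_F.
- by move=> x; apply: integral_ge0.
congr (_ * _); apply: eq_bigr => j _.
rewrite /fubini_F ge0_integral_WT//; last first.
exact: measurableT_comp.
Qed.

Let NJ (c : R) : (N * \sum_(j : J) c = c)%R.
Proof.
rewrite sumr_const card_ord -[X in (_ * X)%R]mulr_natl mulrA mulVf ?mul1r//.
by rewrite pnatr_eq0 -lt0n.
Qed.

Lemma integrable_spiked (f : vec R n * tensor R n d -> R) :
  measurable_fun setT f ->
  (forall (j : J) t, `|f (nth z s j, t)| <= 1)%R ->
  (spike_noise_law X n d).-integrable setT (EFin \o f).
Proof.
move=> mf f1; apply/integrableP; split; first exact/measurable_EFinP.
rewrite ge0_integral_spike_noise//=; last first.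
  by apply/measurable_EFinP; exact: measurableT_comp.
apply: (@le_lt_trans _ _ (N%:E * \sum_(j : J) 1%:E)).
  apply: lee_wpmul2l; first by rewrite lee_fin invr_ge0.
  apply: lee_sum => j _; rewrite -(expect_cst Q 1%R).
  apply: ge0_le_integral => //.
  - apply/measurable_EFinP; apply: measurableT_comp => //; apply: measurableT_comp => //.
    by apply: measurable_fun_pair => //; exact: measurable_symmetrize.
  - by move=> y _; rewrite lee_fin.
by rewrite sumEFin -EFinM ltry.
Qed.

(** Bridges the signed expectation defining recovery and the calculus of nonnegative integrals:
    adding 1 makes the integrand nonnegative on the support of the prior. *)
Lemma expectation_spiked_le (f : vec R n * tensor R n d -> R) :
  measurable_fun setT f ->
  (forall (j : J) t, `|f (nth z s j, t)| <= 1)%R ->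
  'E_(spike_noise_law X n d)[f] + 1 <=
  N%:E * \sum_(j : J) \int[Q]_y (1 + f (nth z s j, symmetrize y))%:E.
Proof.
move=> mf f1.
have intf := integrable_spiked f mf f1.
have -> : 'E_(spike_noise_law X n d)[f] + 1 =
    \int[spike_noise_law X n d]_p (1 + f p)%:E.
  rewrite unlock -(expect_cst (spike_noise_law X n d) 1%R) -integralD//; last first.
    exact: finite_measure_integrable_cst.
  by apply: eq_integral => p _; rewrite EFinD addeC.
have m1f : measurable_fun setT (fun p => (1 + f p)%:E).
  by apply/measurable_EFinP; exact: measurable_funD.
(* Off the support [1 + f] may be negative. The absolute value makes Tonelli applicable and
   disappears again at the support points. *)
apply: (@le_trans _ _ (\int[spike_noise_law X n d]_p `|(1 + f p)%:E|)).
  apply: le_trans (lee_abs _) _.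
  exact: le_abse_integral.
rewrite ge0_integral_spike_noise//; last exact: measurableT_comp.
apply: lee_wpmul2l; first by rewrite lee_fin invr_ge0.
apply: lee_sum => j _; rewrite le_eqVlt; apply/orP; left; apply/eqP.
apply: eq_integral => y _; rewrite gee0_abs// lee_fin.
by have := f1 j (symmetrize y); rewrite ler_norml => /andP[? _]; lra.
Qed.

Lemma expectation_spiked_ge (f : vec R n * tensor R n d -> R) :
  measurable_fun setT f ->
  (forall (j : J) t, `|f (nth z s j, t)| <= 1)%R ->
  1 <= 'E_(spike_noise_law X n d)[f] +
    N%:E * \sum_(j : J) \int[Q]_y (1 - f (nth z s j, symmetrize y))%:E.
Proof.
move=> mf f1; have intf := integrable_spiked f mf f1.
have f1N (j : J) t : (`|- f (nth z s j, t)| <= 1)%R by rewrite normrN.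
have mfN : measurable_fun setT (fun p => - f p)%R by exact: measurableT_comp.
have := expectation_spiked_le (fun p => - f p)%R mfN f1N.
have -> : 'E_(spike_noise_law X n d)[(fun p => - f p)%R] = - 'E_(spike_noise_law X n d)[f].
  rewrite unlock -mulN1e -integralZl//.
  by apply: eq_integral => p _; rewrite mulN1e.
have : 'E_(spike_noise_law X n d)[f] \is a fin_num.
  by rewrite unlock; exact: integrable_fin_num.
case: ('E_(_)[f]) => [r||]// _; set W := (N%:E * _).
by rewrite -EFinN -EFinD; case: W => [x||]//; rewrite -?EFinD ?lee_fin ?leey//; lra.
Qed.

End model.

(** * Bounds for detection and recovery below the threshold *)

Lemma dot_le1 {R : realType} {n} (x y : vec R n) : unit_vec x -> unit_vec y ->
  `|dot x y| <= 1.
Proof.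
have amgm (e : R) : e ^+ 2 = 1 -> unit_vec x -> unit_vec y -> e * dot x y <= 1.
  move=> e1 ux uy; have -> : 1 = (dot x x + dot y y) / 2 by rewrite ux uy; field.
  rewrite /dot -big_split/= mulr_suml mulr_sumr; apply: ler_sum => i _.
  rewrite -subr_ge0 (_ : _ - _ = (e * tnth x i - tnth y i) ^+ 2 / 2).
    by rewrite divr_ge0 ?sqr_ge0.
  by rewrite sqrrB exprMn e1; field.
move=> ux uy; rewrite ler_norml.
have := amgm (-1) (sqrr_sign _ 1) ux uy; have := amgm 1 (expr1n _ _) ux uy; lra.
Qed.

(* Bounds the second moment of the truncated likelihood ratios of two spikes of overlap c. *)
Definition trunc_corr {R : realType} (n d : nat) (l eta tau c : R) : R :=
  if 1 - tau <= `|c| then expR (n%:R * (l ^+ 2 / 4 + l * eta / 2))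
  else expR (n%:R / 2 * (l ^+ 2 * c ^+ d)).

Section lower_bounds.
Context {R : realType} {n d : nat} (z : vec R n) (s : seq (vec R n)).
Context (X : prior_family R).
Hypothesis Xn : X n = uniform_law R z s.
Hypothesis n0 : (0 < n)%N.
Hypothesis s0 : (0 < size s)%N.
Hypothesis us : forall j : 'I_(size s), unit_vec (nth z s j).
Context (l eta tau k : R).
Hypothesis l0 : 0 <= l.
Hypothesis eta0 : 0 < eta.
Hypothesis k0 : 0 < k.

Notation J := 'I_(size s).
Notation Q := (iid_noise R n d).
Let x_ (j : J) := nth z s j.
Let G (j : J) (y : tensor R n d) := tdot (tpow (x_ j)) y <= l + eta.
Let w (j : J) (y : tensor R n d) := lik l (x_ j) y.
Let eps := expR (- (n%:R * eta ^+ 2 / 4)).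

Let M (i j : J) := trunc_corr n d l eta tau (dot (x_ i) (x_ j)).

Let mG j : measurable_fun setT (G j).
Proof. by apply: measurable_fun_ler => //; exact: measurable_tdot. Qed.

Let nw j : ge0_mfun (w j). Proof. exact: ge0_mfun_lik. Qed.

Local Open Scope ereal_scope.

Let w1 j : \int[Q]_y (w j y)%:E = 1.
Proof. exact/integral_lik/us. Qed.

(** Under the law spiked at [x_ j] the statistic is [l] plus noise, so leaving [G j] means that the
    noise exceeds [eta]. *)
Let w_bad j : \int[Q]_y (w j y * (~~ G j y)%:R)%:E <= eps%:E.
Proof.
apply: le_trans (noise_tail (d := d) n0 eta (x_ j) (us j)).
under eq_integral do rewrite mulrC EFinM.
rewrite -(integral_spike n0 l (x_ j) (fun y => (~~ G j y)%:R%:E)) //; last 2 first.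
- exact: (us j).
- by apply/measurable_EFinP; apply: (ge0_mfun_bool _ _).1; exact: measurable_neg.
apply: ge0_le_integral => //.
- apply/measurable_EFinP; apply: (ge0_mfun_bool _ _).1.
  rewrite /G; under eq_fun do rewrite tdot_spike.
  apply: measurable_neg; apply: measurable_fun_ler => //.
  by apply: measurable_funD => //; exact: measurable_tdot.
- apply/measurable_EFinP; apply: (ge0_mfun_bool _ _).1; apply: measurable_fun_ler => //.
  by apply: measurable_funM => //; exact: measurable_tdot.
- move=> y _; rewrite lee_fin ler_nat /G tdot_spike tdot_tpow us expr1n mulr1.
  rewrite lerD2l -ltNge; case: ltP => // h.
  by rewrite expr2 ler_pM2l// ltW.
Qed.

(** For near pairs only one ratio is capped, by its event, and the other integrates to 1: the cost
    is exp(n l^2 / 4) up to the slack, instead of the exp(n l^2 / 2) of the plain correlation at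
    overlap 1. For the other pairs the indicators are dropped. *)
Let w_good i j :
  \int[Q]_y ((w i y * (G i y)%:R) * (w j y * (G j y)%:R))%:E <= (M i j)%:E.
Proof.
have nt i' : ge0_mfun (fun y => w i' y * (G i' y)%:R)%R.
  by apply: ge0_mfunM => //; exact: ge0_mfun_bool.
rewrite /M /trunc_corr; case: ifP => _; last first.
  rewrite -(integral_lik2 n0 l _ _ (us i) (us j)); apply: le_expect.
  - exact: ge0_mfunM.
  - by apply: ge0_mfunM; exact: ge0_mfun_lik.
  - move=> y; apply: ler_pM; [exact: (nt i).2|exact: (nt j).2| |];
      by rewrite ler_piMr ?expR_ge0 ?lern1 ?leq_b1.
set c := expR _.
apply: (@le_trans _ _ (\int[Q]_y (c * w j y)%:E)).
  apply: le_expect.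
  - exact: ge0_mfunM.
  - by apply: ge0_mfunM => //; apply: ge0_mfun_cst; exact: expR_ge0.
  - move=> y; apply: ler_pM; [exact: (nt i).2|exact: (nt j).2| |].
      rewrite /G; case: (leP (tdot _ y)) => h; last by rewrite mulr0 expR_ge0.
      rewrite mulr1 /w /lik /c ler_expR.
      rewrite [leRHS](_ : _ = n%:R / 2 * (l * (l + eta) - l ^+ 2 / 2))%R; last by field.
      by rewrite ler_wpM2l ?divr_ge0// lerD2r ler_wpM2l.
    by rewrite ler_piMr ?expR_ge0 ?lern1 ?leq_b1.
by rewrite ge0_expectZ ?expR_ge0// w1 mule1.
Qed.

Let J0 : (0 < #|J|)%N. Proof. by rewrite card_ord. Qed.

Lemma detection_bound (phi : {mfun tensor R n d >-> bool}) :
  success_prob X l phi <=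
  (2^-1 + (eps + eps / k +
    ((size s)%:R^-1 ^+ 2 * (\sum_i \sum_j M i j) - 1) / (2 * k) + k / 2) / 2)%:E.
Proof.
have mphi : measurable_fun setT phi by [].
have mneg : measurable_fun setT (fun t => ~~ phi t) by exact: measurable_neg.
have mps : measurable_fun setT (fun y : tensor R n d => phi (symmetrize y)).
  by apply: measurableT_comp => //; exact: measurable_symmetrize.
set B := (_ + k / 2)%R.
have : ((size s)%:R^-1)%:E *
    (\sum_(j : J) \int[Q]_y ((phi (symmetrize y))%:R * w j y)%:E) <=
    \int[Q]_y (phi (symmetrize y))%:R%:E + B%:E.
  have := @second_moment_test _ _ _ Q _ w G eps M J0 nw mG w1 w_bad w_good _ k mps k0.
  by rewrite card_ord.
have -> : \int[Q]_y (phi (symmetrize y))%:R%:E = WT R n d [set t | phi t].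
  rewrite prob_bool// ge0_integral_WT//.
  by apply/measurable_EFinP; apply: (ge0_mfun_bool _ _).1.
have -> : ((size s)%:R^-1)%:E *
    \sum_(j : J) \int[Q]_y ((phi (symmetrize y))%:R * w j y)%:E =
    spikedWT X l n d [set t | phi t].
  have mpsp : measurable_fun setT (fun p => phi (@spike_plus_noise R n d l p)).
    by apply: measurableT_comp => //; exact: measurable_spike_plus_noise.
  rewrite -[RHS]/(spike_noise_law X n d [set p | phi (spike_plus_noise l p)]).
  rewrite prob_bool// (ge0_integral_spike_noise z s X Xn s0); last 2 first.
  - by apply/measurable_EFinP; apply: (ge0_mfun_bool _ _).1.
  - by move=> p; rewrite lee_fin.
  congr (_ * _); apply: eq_bigr => j _.
  under eq_integral do rewrite EFinM.
  rewrite -(integral_spike n0 l (x_ j) (fun y => (phi (symmetrize y))%:R%:E))//; last 2 first.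
  - exact: (us j).
  - by apply/measurable_EFinP; apply: (ge0_mfun_bool _ _).1.
  by apply: eq_integral => y _; rewrite symmetrize_spike.
move=> main; rewrite /success_prob.
have WTN : WT R n d [set t | ~~ phi t] = 1 - WT R n d [set t | phi t].
  rewrite -probability_setC; last by rewrite -[X in measurable X]setTI; exact: mphi.
  by congr (WT R n d _); apply/seteqP; split=> t /= /negP.
have pf : WT R n d [set t | phi t] \is a fin_num.
  by apply: fin_num_measure; rewrite -[X in measurable X]setTI; exact: mphi.
rewrite WTN -(fineK pf) -EFinB.
apply: (@le_trans _ _ ((2^-1)%:E * ((fine (WT R n d [set t | phi t]) + B)%:E +
    (1 - fine (WT R n d [set t | phi t]))%:E))).
  rewrite lee_pmul2l// leeD2r// EFinD fineK//.
by rewrite -EFinD -EFinM lee_fin le_eqVlt; apply/orP; left; apply/eqP; rewrite -/B; field.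
Qed.

(** The d-th power of <x, xhat> is the inner product of the tensor powers, which are unit vectors
    too; the overlap bound is applied to these. *)
Lemma recovery_bound (xhat : {mfun tensor R n d >-> vec R n}) :
  (forall t, unit_vec (xhat t)) ->
  'E_(spike_noise_law X n d)[(fun p =>
    dot p.1 (xhat (spike_plus_noise l p)) ^+ d)%R] <=
  (2 * eps + (size s)%:R^-1 ^+ 2 * (\sum_i \sum_j
     `|dot (x_ i) (x_ j)| ^+ d * M i j) / (2 * k) + k / 2)%:E.
Proof.
move=> uxhat.
have mb : measurable_fun setT (fun y : tensor R n d => xhat (symmetrize y)).
  by apply: measurableT_comp => //; exact: measurable_symmetrize.
have mtp i : measurable_fun setT (fun y : tensor R n d =>
    tnth (tpow (xhat (symmetrize y)) : tensor R n d) i).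
  rewrite (_ : (fun y => _) = fun y : tensor R n d =>
    \prod_(j < d) tnth (xhat (symmetrize y)) (enum_val i j))%R; last first.
    by apply/funext => y; rewrite tnth_mktuple.
  apply: measurable_prod => j _.
  exact: (measurableT_comp (measurable_tnth _) mb).
have sq (x : vec R n) : unit_vec x ->
    (\sum_i tnth (tpow x : tensor R n d) i ^+ 2 = 1)%R.
  move=> ux; rewrite -[RHS](expr1n _ d) -ux -tdot_tpow.
  by apply: eq_bigr => i _; rewrite expr2.
have := @second_moment_overlap _ _ _ Q _ w G eps M J0 nw mG w1 w_bad w_good _
  (fun j => tpow (x_ j)) (fun y => tpow (xhat (symmetrize y))) k mtp
  (fun y => sq _ (uxhat _)) (fun j => sq _ (us j)) k0.
rewrite card_ord => main.
have mspike : measurable_fun setT (@spike_plus_noise R n d l).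
  exact: measurable_spike_plus_noise.
have mx : measurable_fun setT (fun p => xhat (@spike_plus_noise R n d l p)).
  exact: measurableT_comp.
have mdot : measurable_fun setT (fun p : vec R n * tensor R n d =>
    dot p.1 (xhat (spike_plus_noise l p)) ^+ d)%R.
  apply: measurable_funX; apply: measurable_sum => i; apply: measurable_funM.
    by apply: (measurableT_comp (measurable_tnth _)); exact: measurable_fst.
  exact: (measurableT_comp (measurable_tnth _) mx).
have f1 (j : J) (t : tensor R n d) :
    (`|dot (x_ j) (xhat (spike_plus_noise l (x_ j, t))) ^+ d| <= 1)%R.
  by rewrite normrX exprn_ile1// dot_le1//; exact: (us j).
have := expectation_spiked_le z s X Xn s0 _ mdot f1.
set B := (_ + k / 2)%R => le1.
have {}main : ((size s)%:R^-1)%:E *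
    (\sum_(j : J) \int[Q]_y (1 + dot (x_ j)
       (xhat (spike_plus_noise l (x_ j, symmetrize y))) ^+ d)%:E) <= (1 + B)%:E.
  rewrite (_ : (1 + B = 1 + 2 * eps + ((size s)%:R^-1 ^+ 2 * (\sum_i \sum_j
      `|dot (x_ i) (x_ j)| ^+ d * M i j)) / (2 * k) + k / 2)%R); last by rewrite /B; ring.
  under [in leRHS]eq_bigr do under eq_bigr do rewrite -normrX -tdot_tpow.
  apply: le_trans main; rewrite le_eqVlt; apply/orP; left; apply/eqP; congr (_ * _).
  apply: eq_bigr => j _; under [RHS]eq_integral do rewrite EFinM.
  rewrite -(integral_spike n0 l (x_ j) (fun y =>
    (1 + \sum_i tnth (tpow (x_ j) : tensor R n d) i *
       tnth (tpow (xhat (symmetrize y)) : tensor R n d) i)%:E)); last 3 first.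
  - exact: (us j).
  - apply/measurable_EFinP; apply: measurable_funD => //.
    by apply: measurable_sum => i; exact: measurable_funM.
  - move=> y; rewrite lee_fin -[X in (1 + X)%R]/(tdot _ _) tdot_tpow.
    have : (`|dot (x_ j) (xhat (symmetrize y)) ^+ d| <= 1)%R.
      by rewrite normrX exprn_ile1// dot_le1//; exact: (us j).
    by rewrite ler_norml; lra.
  apply: eq_integral => y _; rewrite symmetrize_spike -tdot_tpow.
  by [].
have {}main := le_trans le1 main.
by move: main; rewrite EFinD addeC leeD2lE.
Qed.

End lower_bounds.

(** * Cardinality estimates *)

(** The Poisson weights m^j / j! are largest at j = m. *)
Lemma fact_expn_le (m j : nat) : (m`! * m ^ j <= j`! * m ^ m)%N.
Proof.
have [jm|/ltnW mj] := leqP j m.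
  rewrite -(subnKC jm); move: (m - j)%N => r.
  suff H B : (j + r <= B)%N -> ((j + r)`! <= j`! * B ^ r)%N.
    by rewrite expnD [leqRHS]mulnCA [leqLHS]mulnC leq_mul2l H ?orbT.
  elim: r => [|r IH] h; first by rewrite addn0 expn0 muln1.
  rewrite addnS factS expnS mulnCA leq_mul//; first by rewrite -addnS.
  by apply: IH; apply: leq_trans h; rewrite addnS.
rewrite -(subnKC mj); move: (j - m)%N => r.
rewrite expnD (mulnC (m ^ m)%N) mulnA leq_mul2r; apply/orP; right.
elim: r => [|r IH]; first by rewrite addn0 expn0 muln1.
by rewrite addnS factS expnS mulnCA leq_mul// (leq_trans (leq_addr r m)).
Qed.

(* For x = K / n the largest term of the binomial expansion of (x + (1 - x))^n is the K-th one. *)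
Lemma bin_expn_le (K L j : nat) : (j <= K + L)%N ->
  ('C(K + L, j) * (K ^ j * L ^ (K + L - j)) <= 'C(K + L, K) * (K ^ K * L ^ L))%N.
Proof.
move=> jn; have fj := bin_fact jn; have fK := bin_fact (leq_addr L K).
rewrite addKn in fK; set i := (K + L - j)%N in fj *.
have p : (0 < (j`! * i`!) * (K`! * L`!))%N by rewrite !muln_gt0 !fact_gt0.
rewrite -(leq_pmul2l p).
rewrite (_ : _ * _ = (K + L)`! * ((K`! * K ^ j) * (L`! * L ^ i)))%N; last first.
  by rewrite -fj; ring.
rewrite [leqRHS](_ : _ = (K + L)`! * ((j`! * K ^ K) * (i`! * L ^ L)))%N; last first.
  by rewrite -fK; ring.
by rewrite leq_mul2l leq_mul ?orbT// fact_expn_le.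
Qed.

(** The sum (K + L)^(K + L) lies between its largest term and the number of terms times it. *)
Lemma bin_expn_bounds (K L : nat) :
  ('C(K + L, K) * (K ^ K * L ^ L) <= (K + L) ^ (K + L) <=
   (K + L).+1 * ('C(K + L, K) * (K ^ K * L ^ L)))%N.
Proof.
have E : ((K + L) ^ (K + L) = \sum_(i < (K + L).+1)
    'C(K + L, i) * (K ^ i * L ^ (K + L - i)))%N.
  rewrite {1}(addnC K) expnDn; apply: eq_bigr => i _.
  by rewrite (mulnC (L ^ _)%N).
apply/andP; split.
  rewrite E (bigD1 (inord K : 'I_(K + L).+1))//= inordK ?ltnS ?leq_addr//.
  by rewrite addKn leq_addr.
rewrite E -[X in (_ <= X * _)%N]card_ord -sum_nat_const; apply: leq_sum => i _.
by apply: bin_expn_le; rewrite -ltnS.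
Qed.

Section entropy.
Context {R : realType} (K L : nat).
Hypothesis n0 : (0 < K + L)%N.
Let n := (K + L)%N.
Context (rho : R).
Hypothesis rhoE : rho * n%:R = K%:R.

(** The case m = 0 carries the convention 0 log 0 = 0, which matters for the entropy at rho = 1,
    where L = 0. *)
Lemma expR_mul_ln (m : nat) (x : R) : (m = 0%N) \/ 0 < x ->
  expR (m%:R * ln x) = x ^+ m.
Proof.
case=> [->|x0]; first by rewrite mul0r expR0 expr0.
by rewrite expRM_natl lnK.
Qed.

Let n0R : 0 < n%:R :> R. Proof. by rewrite ltr0n. Qed.

Lemma expR_entropy :
  expR (n%:R * binary_entropy rho) * (K ^ K * L ^ L)%:R = (n ^ n)%:R.
Proof.
have rK : rho = K%:R / n%:R by rewrite -rhoE mulfK// gt_eqF.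
have rL : 1 - rho = L%:R / n%:R.
  by rewrite rK /n natrD; field; rewrite -natrD gt_eqF.
have -> : n%:R * binary_entropy rho = - (K%:R * ln (K%:R / n%:R)) - L%:R * ln (L%:R / n%:R).
  rewrite /binary_entropy rL {1 2}rK.
  by field; rewrite gt_eqF.
rewrite expRD !expRN !expR_mul_ln; last 2 first.
- by case: (posnP L) => [|L0]; [left|right; rewrite divr_gt0 ?ltr0n].
- by case: (posnP K) => [|K0]; [left|right; rewrite divr_gt0 ?ltr0n].
have h m : (m%:R / n%:R : R) ^+ m != 0.
  case: m => [|m]; first by rewrite expr0 oner_eq0.
  by rewrite expf_eq0/= mulf_eq0 invr_eq0 !gt_eqF ?ltr0n.
have E m : ((m%:R / n%:R : R) ^+ m)^-1 * (m ^ m)%:R = n%:R ^+ m.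
  apply: (mulfI (h m)); rewrite mulrA mulfV// mul1r -exprMn natrX.
  by rewrite divfK// gt_eqF.
rewrite natrM mulrACA !E -exprD -natrX.
by [].
Qed.

Lemma bin_entropy_bounds : 'C(n, K)%:R <= expR (n%:R * binary_entropy rho) /\
  expR (n%:R * binary_entropy rho) <= n.+1%:R * 'C(n, K)%:R.
Proof.
have p : 0 < (K ^ K * L ^ L)%:R :> R.
  by rewrite ltr0n muln_gt0 !expn_gt0; case: (K) (L) => [|?] [|?].
have /andP[le1 le2] := bin_expn_bounds K L.
split; rewrite -(ler_pM2r p) expR_entropy.
  by rewrite -natrM ler_nat.
by rewrite -!natrM ler_nat -mulnA.
Qed.

(* The exponential growth rate of the number of points in the support of the prior. *)
Lemma support_card_bounds (h := binary_entropy rho + rho * ln 2) :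
  ('C(n, K) * 2 ^ K)%:R <= expR (n%:R * h) /\
  expR (n%:R * h) <= n.+1%:R * ('C(n, K) * 2 ^ K)%:R.
Proof.
have -> : expR (n%:R * h) = expR (n%:R * binary_entropy rho) * 2 ^+ K.
  rewrite (_ : n%:R * h = n%:R * binary_entropy rho + K%:R * ln 2).
    by rewrite expRD expR_mul_ln//; right.
  by rewrite /h -rhoE; ring.
have [le1 le2] := bin_entropy_bounds; have p : 0 < 2 ^+ K :> R by exact: exprn_gt0.
by rewrite natrM natrX mulrA !ler_pM2r.
Qed.

End entropy.

(** * Bounds on the moment generating function of a random sign *)

Section cosh.
Context {R : realType}.

Definition cosh (a : R) : R := (expR a + expR (- a)) / 2.

Lemma coshN a : cosh (- a) = cosh a.
Proof. by rewrite /cosh opprK addrC. Qed.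

Lemma cosh_gt0 a : 0 < cosh a.
Proof. by rewrite divr_gt0// addr_gt0// expR_gt0. Qed.

Lemma cosh_ge1 a : 1 <= cosh a.
Proof.
have := expR_ge1Dx a; have := expR_ge1Dx (- a); rewrite /cosh; lra.
Qed.

(** The constant 2 in place of the sharp 1/2 allows an elementary proof: for 0 <= a <= 1/2 the bound
    exp(b) <= 1 / (1 - b) at b = a and b = -a gives cosh a <= 1 / (1 - a^2) <= 1 + 2 a^2; beyond 1/2
    one has a <= 2 a^2. *)
Lemma cosh_le a : cosh a <= expR (2 * a ^+ 2).
Proof.
wlog a0 : a / 0 <= a => [H|].
  by case: (leP 0 a) => [/H//|/ltW a0]; rewrite -coshN -sqrrN; apply: H; rewrite oppr_ge0.
have [a1|a1] := leP a (2^-1); last first.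
  apply: (@le_trans _ _ (expR a)); last by rewrite ler_expR; nra.
  have : expR (- a) <= expR a by rewrite ler_expR; lra.
  by rewrite /cosh; lra.
have inv (b : R) : b < 1 -> expR b <= (1 - b)^-1.
  move=> b1; rewrite -[b in leLHS]opprK expRN lef_pV2 ?posrE ?expR_gt0 ?subr_gt0//.
  exact: expR_ge1Dx.
have h1 : expR a <= (1 - a)^-1 by apply: inv; lra.
have h2 : expR (- a) <= (1 + a)^-1 by have := inv (- a); rewrite opprK; apply; lra.
have h3 : 1 + 2 * a ^+ 2 <= expR (2 * a ^+ 2) by exact: expR_ge1Dx.
apply: le_trans h3; apply: (@le_trans _ _ (((1 - a)^-1 + (1 + a)^-1) / 2)).
  by rewrite /cosh; lra.
have -> : ((1 - a)^-1 + (1 + a)^-1) / 2 = (1 - a ^+ 2)^-1.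
  by field; apply/and3P; split; apply/eqP; nra.
have : a ^+ 2 <= 2^-1 by nra.
have := sqr_ge0 a; move: (a ^+ 2) => b b0 b1.
rewrite -[leLHS]mul1r ler_pdivrMr; first by nra.
by rewrite subr_gt0; lra.
Qed.

(** Isolates the leading term exp(a) / 2, whose factor 1/2 per coordinate of the support yields the
    2^K sign patterns in the near-pair estimate. *)
Lemma expR_cosh_half a : 0 <= a ->
  expR (a / 2) + cosh a <= expR a / 2 * expR (3 * expR (- a / 2)).
Proof.
move=> a0; apply: (@le_trans _ _ (expR a / 2 * (1 + 3 * expR (- a / 2)))); last first.
  by rewrite ler_wpM2l ?divr_ge0 ?expR_ge0// expR_ge1Dx.
have E1 : expR a * expR (- a / 2) = expR (a / 2) by rewrite -expRD; congr expR; field.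
have E2 : expR (- a) <= expR (a / 2) by rewrite ler_expR; lra.
rewrite /cosh; nra.
Qed.

End cosh.

(** * Overlaps of sparse Rademacher vectors *)

Section sparse_overlap.
Context {R : realType} (n K : nat) (rho : R).
Hypothesis K0 : (0 < K)%N.
Hypothesis Kn : (K <= n)%N.
Hypothesis rhoE : rho * n%:R = K%:R.

Let K0R : 0 < K%:R :> R. Proof. by rewrite ltr0n. Qed.

Definition is_sparse (x : vec R n) :=
  exists (S : {set 'I_n}) (u : {ffun 'I_n -> bool}), #|S| = K /\ x = sparse_vec rho S u.

Lemma dot_sparse (S S' : {set 'I_n}) (u u' : {ffun 'I_n -> bool}) :
  K%:R * dot (sparse_vec rho S u) (sparse_vec rho S' u') =
  \sum_(i in S :&: S') (-1) ^+ u i * (-1) ^+ u' i.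
Proof.
rewrite /dot mulr_sumr [RHS]big_mkcond; apply: eq_bigr => i _.
rewrite !tnth_mktuple inE rhoE.
case: (i \in S); case: (i \in S'); rewrite ?(mul0r, mulr0)//=.
rewrite mulrACA -invfM -expr2 sqr_sqrtr ?ler0n// mulrCA divff ?mulr1//.
by rewrite gt_eqF.
Qed.

(** Overlaps lie on a grid of mesh 1 / K, so intermediate overlaps are handled by a union over K + 1
    values. *)
Lemma dot_sparse_int (x x' : vec R n) : is_sparse x -> is_sparse x' ->
  exists2 j : nat, (j <= K)%N & K%:R * `|dot x x'| = j%:R.
Proof.
move=> [S [u [cS ->]]] [S' [u' [cS' ->]]].
pose z : int := \sum_(i in S :&: S') (-1) ^+ u i * (-1) ^+ u' i.
have E : \sum_(i in S :&: S') (-1) ^+ u i * (-1) ^+ u' i = z%:~R :> R.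
  rewrite rmorph_sum/=; apply: eq_bigr => i _.
  by rewrite rmorphM !rmorphXn rmorphN1.
exists (absz z).
  rewrite -lez_nat abszE; apply: le_trans (ler_norm_sum _ _ _) _.
  under eq_bigr do rewrite normrM !normrX normrN1 !expr1n mulr1.
  by rewrite sumr_const -cS natz lez_nat subset_leq_card// subsetIl.
by rewrite -[in LHS](gtr0_norm K0R) -normrM dot_sparse E -intr_norm natr_absz.
Qed.

(** Expectation under the prior; the factor 2^n appears because signs are drawn on all
    coordinates. *)
Definition prior_avg (F : vec R n -> R) : R :=
  ('C(n, K) * 2 ^ n)%:R^-1 * \sum_(S : {set 'I_n} | #|S| == K)
    \sum_(u : {ffun 'I_n -> bool}) F (sparse_vec rho S u).

Let C0 : 0 < ('C(n, K) * 2 ^ n)%:R :> R.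
Proof. by rewrite ltr0n muln_gt0 bin_gt0 Kn expn_gt0. Qed.

Lemma prior_avg_le (F G : vec R n -> R) : (forall x, is_sparse x -> F x <= G x) ->
  prior_avg F <= prior_avg G.
Proof.
move=> FG; rewrite ler_wpM2l ?invr_ge0 ?(ltW C0)//.
apply: ler_sum => S /eqP cS; apply: ler_sum => u _; apply: FG.
by exists S, u.
Qed.

Lemma prior_avgD (F G : vec R n -> R) : prior_avg (fun x => F x + G x) = prior_avg F + prior_avg G.
Proof.
rewrite /prior_avg -mulrDr -big_split/=; congr (_ * _).
by apply: eq_bigr => S _; rewrite big_split.
Qed.

Lemma prior_avgZ c (F : vec R n -> R) : prior_avg (fun x => c * F x) = c * prior_avg F.
Proof.
rewrite /prior_avg mulrCA; congr (_ * _); rewrite mulr_sumr; apply: eq_bigr => S _.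
by rewrite mulr_sumr.
Qed.

Lemma prior_avg_sum m (F : 'I_m -> vec R n -> R) :
  prior_avg (fun x => \sum_j F j x) = \sum_j prior_avg (F j).
Proof.
rewrite /prior_avg -mulr_sumr; congr (_ * _); rewrite [RHS]exchange_big/=.
by apply: eq_bigr => S _; rewrite exchange_big.
Qed.

Let cardK : #|[pred S : {set 'I_n} | #|S| == K]| = 'C(n, K).
Proof.
rewrite -[in RHS](card_ord n) -card_draws -sum1dep_card.
by rewrite sum1_card.
Qed.

Lemma prior_avg_cst c : prior_avg (fun=> c) = c.
Proof.
rewrite /prior_avg; under eq_bigr do rewrite sumr_const.
rewrite sumr_const -mulrnA card_ffun card_bool card_ord cardK (mulnC (2 ^ n)%N).
by rewrite -(mulr_natl c) mulKf// gt_eqF.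
Qed.

(** Given the support S', the signs are independent: each common coordinate contributes cosh a
    whatever the sign of [u] there, every other coordinate contributes 1. *)
Lemma prior_avg_mgf (S : {set 'I_n}) (u : {ffun 'I_n -> bool}) (a : R) :
  prior_avg (fun x => expR (a * (K%:R * dot (sparse_vec rho S u) x))) =
  'C(n, K)%:R^-1 * \sum_(S' : {set 'I_n} | #|S'| == K) cosh a ^+ #|S :&: S'|.
Proof.
rewrite /prior_avg natrM invfM -mulrA; congr (_ * _); rewrite mulr_sumr.
apply: eq_bigr => S' _.
pose f i (b : bool) := if i \in S :&: S' then expR (a * ((-1) ^+ u i * (-1) ^+ b)) else 1 : R.
transitivity ((2 ^ n)%:R^-1 * \prod_(i < n) \sum_b f i b).
  rewrite bigA_distr_bigA/=; congr (_ * _); apply: eq_bigr => u' _.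
  by rewrite dot_sparse mulr_sumr expR_sum [LHS]big_mkcond.
have -> : (2 ^ n)%:R^-1 = \prod_(i < n) 2^-1 :> R.
  by rewrite prodr_const card_ord natrX exprVn.
rewrite -big_split/=.
rewrite -[RHS]prodr_const [RHS]big_mkcond/=; apply: eq_bigr => i _.
rewrite big_bool /f; case: ifP => _; last by rewrite mulVf.
by rewrite /cosh; case: (u i); rewrite /= ?expr0 ?expr1; rewrite ?(mul1r,mulr1,mulrN1,mulN1r,opprK); ring.
Qed.

Lemma prior_avg_hoeffding (x : vec R n) (a : R) : is_sparse x ->
  prior_avg (fun x' => expR (a * (K%:R * dot x x'))) <= expR (2 * a ^+ 2 * K%:R).
Proof.
move=> [S [u [cS ->]]]; rewrite prior_avg_mgf.
have C1 : 0 < 'C(n, K)%:R :> R by rewrite ltr0n bin_gt0.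
rewrite mulrC ler_pdivrMr// (mulr_natr (expR _)) -cardK -sumr_const.
rewrite [leRHS](eq_bigl (fun S0 : {set 'I_n} => #|S0| == K))//; apply: ler_sum => S0 _.
apply: (@le_trans _ _ (cosh a ^+ K)).
  by rewrite -cS ler_weXn2l ?cosh_ge1// subset_leq_card// subsetIl.
by rewrite expRM_natr lerXn2r ?nnegrE ?expR_ge0 ?(ltW (cosh_gt0 _))// cosh_le.
Qed.

(** Replaces counting the spikes close to x or -x. The main term is what x' = x (or -x) alone
    contributes, namely exp(a K) divided by the number of spikes; all other spikes cost only a
    factor exp(4 n exp(-a / 2)), a small rate once the fixed tilt [a] is large. *)
Lemma prior_avg_near_mgf (x : vec R n) (a : R) (e : bool) : is_sparse x -> 0 <= a ->
  prior_avg (fun x' => expR ((-1) ^+ e * a * (K%:R * dot x x'))) <=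
  expR (a * K%:R + 4 * n%:R * expR (- a / 2)) / ('C(n, K) * 2 ^ K)%:R.
Proof.
move=> [S [u [cS ->]]] a0; rewrite prior_avg_mgf.
have -> : cosh ((-1) ^+ e * a) = cosh a.
  by case: e; rewrite ?expr1 ?expr0 ?mul1r// mulN1r coshN.
have C1 : 0 < 'C(n, K)%:R :> R by rewrite ltr0n bin_gt0.
(* This weight is small enough for (1 + v)^n to have small rate, and large enough for 1 / v to be
   negligible beside cosh a. *)
set v := expR (- a / 2); set c := cosh a.
have v0 : 0 < v by exact: expR_gt0.
have c0 : 0 < c by exact: cosh_gt0.
(* Dropping the constraint #|S'| = K at the cost of a weight v^(#|S'| - K) factorises the sum. *)
have step1 : \sum_(S' : {set 'I_n} | #|S'| == K) c ^+ #|S :&: S'| <=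
    v ^- K * ((1 + v) ^+ (n - K) * (1 + v * c) ^+ K).
  rewrite -[leLHS](mulKf (lt0r_neq0 (exprn_gt0 K v0))) ler_pM2l ?invr_gt0 ?exprn_gt0//.
  have -> : (1 + v) ^+ (n - K) * (1 + v * c) ^+ K =
      \prod_(i < n) (v * (if i \in S then c else 1) + 1).
    rewrite (bigID (mem S))/= mulrC; congr (_ * _).
      rewrite -cS -prodr_const; apply: eq_bigr => i -> ; exact: addrC.
    rewrite (eq_bigr (fun=> 1 + v)); last by move=> i /negbTE ->; rewrite mulr1 addrC.
    rewrite prodr_const; congr (_ ^+ _); rewrite -cS.
    by rewrite -[X in (X - _)%N](card_ord n) -(cardC S) addKn.
  rewrite bigA_distr/= mulr_sumr big_mkcond/=; apply: ler_sum => S' _.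
  have E : \prod_(i < n) (if i \in S' then v * (if i \in S then c else 1) else 1) =
      v ^+ #|S'| * c ^+ #|S :&: S'|.
    rewrite -big_mkcond big_split/= prodr_const; congr (_ * _).
    rewrite -prodr_const -big_mkcondr/=; apply: eq_bigl => i.
    by rewrite inE andbC.
  rewrite E; case: eqP => [->//|_].
  by rewrite mulr_ge0 ?exprn_ge0// ltW.
apply: (@le_trans _ _ ('C(n, K)%:R^-1 * (expR (a * K%:R + 4 * n%:R * v) / 2 ^+ K))); last first.
  by rewrite natrM natrX invfM mulrCA mulrA.
rewrite ler_pM2l ?invr_gt0//; apply: le_trans step1 _.
have -> : v ^- K * ((1 + v) ^+ (n - K) * (1 + v * c) ^+ K) =
    (1 + v) ^+ (n - K) * (v^-1 + c) ^+ K.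
  rewrite mulrCA; congr (_ * _); rewrite -exprVn -exprMn; congr (_ ^+ _).
  by rewrite mulrDr mulr1 mulKf// gt_eqF.
have h1 : (1 + v) ^+ (n - K) <= expR (n%:R * v).
  apply: (@le_trans _ _ (expR v ^+ (n - K))).
    by rewrite lerXn2r ?nnegrE ?expR_ge0 ?addr_ge0 ?(ltW v0)// expR_ge1Dx.
  by rewrite expRM_natl ler_weXn2l ?leq_subr// -expR0 ler_expR ltW.
have h2 : (v^-1 + c) ^+ K <= expR (a * K%:R) / 2 ^+ K * expR (3 * n%:R * v).
  apply: (@le_trans _ _ ((expR a / 2 * expR (3 * v)) ^+ K)).
    rewrite lerXn2r ?nnegrE ?mulr_ge0 ?divr_ge0 ?expR_ge0 ?addr_ge0 ?invr_ge0 ?(ltW v0) ?(ltW c0)//.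
    have -> : v^-1 = expR (a / 2) by rewrite /v -expRN; congr expR; ring.
    exact: expR_cosh_half.
  rewrite exprMn exprMn exprVn -expRM_natr ler_pM2l ?divr_gt0 ?expR_gt0 ?exprn_gt0//.
  by rewrite -expRM_natr ler_expR mulrAC ler_wpM2r ?(ltW v0)// ler_wpM2l// ler_nat.
apply: (@le_trans _ _ (expR (n%:R * v) * (expR (a * K%:R) / 2 ^+ K * expR (3 * n%:R * v)))).
  apply: ler_pM => //; rewrite exprn_ge0// addr_ge0 ?invr_ge0 ?(ltW v0) ?(ltW c0)//.
rewrite (_ : _ + _ = n%:R * v + a * K%:R + 3 * n%:R * v); last by ring.
by rewrite !expRD le_eqVlt; apply/orP; left; apply/eqP; ring.
Qed.

End sparse_overlap.

(** * Averaging the truncated correlation over the second spike *)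

Section trunc_average.
Context {R : realType} (n K d : nat) (rho l eta tau t a : R).
Hypothesis K0 : (0 < K)%N.
Hypothesis Kn : (K <= n)%N.
Hypothesis rhoE : rho * n%:R = K%:R.
Hypothesis t0 : 0 <= t.
Hypothesis a0 : 0 <= a.
Hypothesis mid : forall r, 0 <= r <= 1 - tau ->
  n%:R / 2 * (l ^+ 2 * r ^+ d) <= K%:R / 16 * r ^+ 2.

Notation avg := (prior_avg n K rho).
Let K0R : 0 < K%:R :> R. Proof. by rewrite ltr0n. Qed.

Let expR_abs (b c : R) : 0 <= b -> expR (b * `|c|) <=
  expR ((-1) ^+ false * b * c) + expR ((-1) ^+ true * b * c).
Proof.
move=> b0; rewrite /= expr0 expr1 mul1r mulN1r.
have p1 := expR_ge0 (b * c); have p2 := expR_ge0 (- b * c).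
by case: (ger0P c) => _; rewrite ?mulrN -?mulNr ?lerDl ?lerDr.
Qed.

Let avg_abs_le (x : vec R n) (b B : R) : 0 <= b ->
  (forall e : bool, avg (fun x' => expR ((-1) ^+ e * b * (K%:R * dot x x'))) <= B) ->
  avg (fun x' => expR (b * (K%:R * `|dot x x'|))) <= 2 * B.
Proof.
move=> b0 h; apply: (@le_trans _ _ (avg (fun x' =>
    expR ((-1) ^+ false * b * (K%:R * dot x x')) +
    expR ((-1) ^+ true * b * (K%:R * dot x x'))))).
  apply: prior_avg_le => // x' _.
  by rewrite -[X in X * `|_|](gtr0_norm K0R) -normrM expR_abs.
by rewrite prior_avgD mulr_natl mulr2n lerD.
Qed.

(** Chernoff weight of the overlap j / K. The correlation gives exp(j^2 / (16 K)) by [mid]; the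
    optimal tilt j / (4 K) gives -j^2 / (4 K), and its moment generating function j^2 / (8 K). The
    exponents sum to -j^2 / (16 K). *)
Let grid (j : nat) : R := if t * K%:R < j%:R then
  expR (j%:R ^+ 2 / (16 * K%:R) - j%:R ^+ 2 / (4 * K%:R)) else 0.

(** The three terms come from overlaps up to [t], between [t] and 1 - tau, and beyond. The boolean
    [e] switches on the weight |<x, x'>|^d, so that one proof serves detection and recovery. *)
Lemma prior_avg_trunc_le (x : vec R n) (e : bool) : is_sparse n K rho x ->
  (forall x', is_sparse n K rho x' -> `|dot x x'| <= 1) ->
  avg (fun x' => (`|dot x x'| ^+ d) ^+ e * trunc_corr n d l eta tau (dot x x')) <=
  (t ^+ d) ^+ e * expR (n%:R / 2 * (l ^+ 2 * t ^+ d)) +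
  2 * K.+1%:R * expR (- (t ^+ 2 * K%:R / 16)) +
  2 * expR (n%:R * (l ^+ 2 / 4 + l * eta / 2)) *
    (expR (a * tau * K%:R + 4 * n%:R * expR (- a / 2)) / ('C(n, K) * 2 ^ K)%:R).
Proof.
move=> sx x1; set c := expR (n%:R * _).
(* Markov's inequality with tilt [a]: the factor exp(a K (|<x, x'>| - (1 - tau))) is at least 1 on
   near pairs. *)
pose near x' := c * expR (- a * (1 - tau) * K%:R) * expR (a * (K%:R * `|dot x x'|)).
pose term (j : 'I_K.+1) x' := grid j * expR (j%:R / (4 * K%:R) * (K%:R * `|dot x x'|)).
have gridge0 j : 0 <= grid j by rewrite /grid; case: ifP => // _; exact: expR_ge0.
have term0 j x' : 0 <= term j x' by rewrite mulr_ge0 ?expR_ge0.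
have near0 x' : 0 <= near x' by rewrite !mulr_ge0 ?expR_ge0.
set A := (t ^+ d) ^+ e * _.
have A0 : 0 <= A by rewrite mulr_ge0 ?expR_ge0 ?exprn_ge0.
apply: (@le_trans _ _ (avg (fun x' => A + \sum_j term j x' + near x'))).
  apply: prior_avg_le => // x' sx'; have z1 := x1 x' sx'; have [j jK jE] := dot_sparse_int n K rho K0 rhoE x x' sx sx'.
  set z := dot x x' in z1 jE *.
  have w1 : 0 <= (`|z| ^+ d) ^+ e <= 1 by rewrite !exprn_ge0//= !exprn_ile1 ?exprn_ge0.
  have sum0 : 0 <= \sum_j0 term j0 x' by apply: sumr_ge0.
  rewrite /trunc_corr; case: ifP => [zt|/negbT].
    apply: (@le_trans _ _ (near x')); last by rewrite lerDr addr_ge0.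
    apply: (@le_trans _ _ c); first by rewrite ler_piMl ?expR_ge0//; case/andP: w1.
    rewrite /near -mulrA ler_peMr ?expR_ge0// -expRD -[leLHS]expR0 ler_expR -/z.
    rewrite (_ : _ + _ = a * K%:R * (`|z| - (1 - tau))); last by ring.
    by rewrite !mulr_ge0 ?subr_ge0// ltW.
  rewrite -ltNge => zt.
  have zd : z ^+ d <= `|z| ^+ d by rewrite -normrX ler_norm.
  have le1 : expR (n%:R / 2 * (l ^+ 2 * z ^+ d)) <= expR (n%:R / 2 * (l ^+ 2 * `|z| ^+ d)).
    by rewrite ler_expR !ler_wpM2l ?divr_ge0 ?sqr_ge0.
  have [tz|tz] := leP `|z| t.
    apply: (@le_trans _ _ A); last by rewrite -addrA lerDl addr_ge0.
    have td : `|z| ^+ d <= t ^+ d by rewrite lerXn2r.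
    apply: ler_pM; rewrite ?exprn_ge0 ?expR_ge0//.
      by rewrite lerXn2r ?nnegrE ?exprn_ge0.
    by apply: le_trans le1 _; rewrite ler_expR !ler_wpM2l ?divr_ge0 ?sqr_ge0.
  apply: (@le_trans _ _ (term (inord j) x')); last first.
    rewrite -addrA; apply: ler_wpDl => //; apply: ler_wpDr => //.
    by rewrite (bigD1 (inord j))//= lerDl sumr_ge0.
  apply: (@le_trans _ _ (expR (n%:R / 2 * (l ^+ 2 * z ^+ d)))).
    by rewrite ler_piMl ?expR_ge0//; case/andP: w1.
  apply: le_trans le1 _; rewrite /term /grid inordK ?ltnS// -jE -/z.
  have -> : t * K%:R < K%:R * `|z| by rewrite mulrC ltr_pM2l.
  rewrite -expRD ler_expR.
  rewrite [leRHS](_ : _ = K%:R / 16 * `|z| ^+ 2); last by field; rewrite gt_eqF.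
  by apply: mid; rewrite normr_ge0/= ltW.
rewrite !prior_avgD prior_avg_cst// prior_avg_sum; apply: lerD; first apply: lerD => //.
  apply: (@le_trans _ _ (\sum_(j < K.+1) 2 * expR (- (t ^+ 2 * K%:R / 16)))); last first.
    by rewrite sumr_const card_ord -(mulr_natl (2 * _)) mulrA (mulrC K.+1%:R).
  apply: ler_sum => j _; rewrite /term prior_avgZ.
  have jK0 : 0 <= (j%:R / (4 * K%:R) : R) by rewrite divr_ge0// mulr_ge0.
  apply: (@le_trans _ _ (grid j * (2 * expR (2 * (j%:R / (4 * K%:R)) ^+ 2 * K%:R)))).
    rewrite ler_wpM2l//; apply: avg_abs_le => // e'.
    apply: le_trans (prior_avg_hoeffding n K rho K0 Kn rhoE x _ sx) _.
    by rewrite ler_expR exprMn sqrr_sign mul1r.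
  rewrite /grid; case: ifP => [tj|_]; last by rewrite mul0r mulr_ge0 ?expR_ge0.
  rewrite mulrCA ler_pM2l// -expRD ler_expR.
  rewrite [leLHS](_ : _ = - (j%:R ^+ 2 / (16 * K%:R))); last by field; rewrite gt_eqF.
  rewrite lerN2 -subr_ge0.
  rewrite (_ : _ - _ = (j%:R ^+ 2 - (t * K%:R) ^+ 2) / (16 * K%:R)); last by field; rewrite gt_eqF.
  rewrite divr_ge0 ?mulr_ge0// subr_ge0 lerXn2r ?nnegrE ?mulr_ge0//; exact: ltW.
rewrite /near prior_avgZ (mulrC 2 c) -(mulrA c _ (prior_avg _ _ _ _)) -(mulrA c 2) ler_pM2l ?expR_gt0//.
set B := expR (a * K%:R + 4 * n%:R * expR (- a / 2)) / ('C(n, K) * 2 ^ K)%:R.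
apply: (@le_trans _ _ (expR (- a * (1 - tau) * K%:R) * (2 * B))).
  rewrite ler_wpM2l ?expR_ge0//; apply: avg_abs_le => // e'.
  exact: prior_avg_near_mgf.
rewrite mulrCA ler_pM2l// /B mulrA -expRD.
rewrite le_eqVlt; apply/orP; left; apply/eqP; congr (expR _ / _); ring.
Qed.

End trunc_average.

(** * Vanishing of the truncated second moment *)

Section prior_average.
Context {R : realType} (n K : nat) (rho : R).
Hypothesis K0 : (0 < K)%N.
Hypothesis Kn : (K <= n)%N.
Hypothesis rhoE : rho * n%:R = K%:R.

Definition sparse_seq : seq (vec R n) :=
  [seq sparse_vec rho p.1 p.2
     | p : {set 'I_n} * {ffun 'I_n -> bool} <- enum predT & #|p.1|%:R == rho * n%:R].

Lemma sparse_seqP x : x \in sparse_seq -> is_sparse n K rho x.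
Proof.
move=> /mapP[[S u]]; rewrite mem_filter rhoE eqr_nat => /andP[/eqP cS _] ->.
by exists S, u.
Qed.

Let sum_sparse_seq (z : vec R n) (F : vec R n -> R) :
  \sum_(j < size sparse_seq) F (nth z sparse_seq j) =
  \sum_(S : {set 'I_n} | #|S| == K) \sum_(u : {ffun 'I_n -> bool}) F (sparse_vec rho S u).
Proof.
transitivity (\sum_(x <- sparse_seq) F x); first by rewrite (big_nth z) big_mkord.
rewrite pair_big_dep/=.
rewrite big_map big_filter big_enum_cond/=; apply: eq_bigl => p.
by rewrite rhoE eqr_nat andbT.
Qed.

Let C0 : (0 < 'C(n, K) * 2 ^ n)%N.
Proof. by rewrite muln_gt0 bin_gt0 Kn expn_gt0. Qed.

Lemma size_sparse_seq : size sparse_seq = ('C(n, K) * 2 ^ n)%N.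
Proof.
apply/eqP; rewrite -(eqr_nat R) -[X in X%:R == _]card_ord -sumr_const.
rewrite (eq_bigr (fun=> 1))// (sum_sparse_seq [tuple 0 | _ < n] (fun=> 1)).
have C1 : ('C(n, K) * 2 ^ n)%:R != 0 :> R by rewrite pnatr_eq0 -lt0n.
have := prior_avg_cst n K rho Kn 1; rewrite /prior_avg => /(canRL (mulVKf C1)) ->.
by rewrite mulr1.
Qed.

Lemma prior_avgE (z : vec R n) (F : vec R n -> R) :
  (size sparse_seq)%:R^-1 * \sum_(j < size sparse_seq) F (nth z sparse_seq j) =
  prior_avg n K rho F.
Proof. by rewrite sum_sparse_seq size_sparse_seq. Qed.

Lemma pair_avg_le (z : vec R n) (F : vec R n -> vec R n -> R) (B : R) :
  (forall x, is_sparse n K rho x -> prior_avg n K rho (F x) <= B) ->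
  (size sparse_seq)%:R^-1 ^+ 2 * (\sum_(i < size sparse_seq) \sum_(j < size sparse_seq)
    F (nth z sparse_seq i) (nth z sparse_seq j)) <= B.
Proof.
move=> FB; rewrite expr2 -mulrA mulr_sumr.
under eq_bigr do rewrite prior_avgE.
rewrite (prior_avgE z (fun x => prior_avg n K rho (F x))) -[leRHS](prior_avg_cst n K rho Kn).
exact: prior_avg_le.
Qed.

End prior_average.

(** * Elementary decay estimates *)

Section asymptotics.
Context {R : realType}.

Lemma expRN_le_inv (x : R) : 0 < x -> expR (- x) <= x^-1.
Proof.
move=> x0; rewrite expRN lef_pV2 ?posrE ?expR_gt0//.
by apply: le_trans (expR_ge1Dx x); rewrite lerDr.
Qed.

(** A cube is enough to beat the number of grid values, of order q^4, when x is of order q^2. *)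
Lemma expRN_le_inv3 (x : R) : 0 < x -> expR (- x) <= 27 / x ^+ 3.
Proof.
move=> x0; have -> : - x = 3%:R * - (x / 3) by field.
rewrite expRM_natl; apply: (@le_trans _ _ ((x / 3)^-1 ^+ 3)).
  by rewrite lerXn2r ?nnegrE ?invr_ge0 ?divr_ge0 ?expR_ge0 ?(ltW x0)// expRN_le_inv// divr_gt0.
by rewrite le_eqVlt; apply/orP; left; apply/eqP; field; rewrite gt_eqF.
Qed.

Lemma expR_le_lin (y : R) : 0 <= y <= 2^-1 -> expR y <= 1 + 2 * y.
Proof.
move=> /andP[y0 y1]; have h : 1 - y <= expR (- y) by exact: expR_ge1Dx.
rewrite -[y in leLHS]opprK expRN -[leLHS]mul1r ler_pdivrMr ?expR_gt0//.
apply: le_trans (ler_wpM2l _ h); last by lra.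
nra.
Qed.

(** Two factors r are kept for comparison with the Gaussian tail, and the remaining r^(d - 2) <=
    exp(-tau m) <= 1 / (1 + m tau) absorbs the constants. [D] is uniform over l' <= l, as required
    for all signal levels below a given one. *)
Lemma overlap_decay (rho l tau : R) : 0 < rho -> 0 < tau -> 0 <= l ->
  exists D, forall d l', (D <= d)%N -> 0 <= l' <= l -> forall r, 0 <= r <= 1 - tau ->
  l' ^+ 2 * r ^+ d / 2 <= rho / 16 * r ^+ 2.
Proof.
move=> rho0 tau0 l0; pose m := (Num.trunc (8 * l ^+ 2 / (rho * tau))).+1.
have hm : 8 * l ^+ 2 / (rho * tau) <= m%:R by apply: ltW; exact: truncnS_gt.
exists m.+2 => d l' dm /andP[l'0 l'l] r /andP[r0 rt].
have dm2 : (m <= d - 2)%N by rewrite leq_subRL ?add2n// (leq_trans _ dm).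
have -> : l' ^+ 2 * r ^+ d / 2 = l' ^+ 2 * r ^+ (d - 2) / 2 * r ^+ 2.
  have d2 : (d = d - 2 + 2)%N by rewrite subnK// (leq_trans _ dm).
  by rewrite {1}d2 exprD; ring.
rewrite ler_wpM2r ?sqr_ge0//.
have rle : r <= expR (- tau) by apply: le_trans rt _; exact: expR_ge1Dx.
have rm : r ^+ (d - 2) <= (1 + m%:R * tau)^-1.
  apply: (@le_trans _ _ (r ^+ m)).
    apply: ler_wiXn2l => //.
    by apply: le_trans rt _; rewrite gerBl ltW.
  apply: (@le_trans _ _ (expR (- tau) ^+ m)).
    by rewrite lerXn2r ?nnegrE ?expR_ge0.
  rewrite -expRM_natl mulrN expRN lef_pV2 ?posrE ?expR_gt0 ?expR_ge1Dx//.
  by rewrite addr_gt0// mulr_gt0// ltr0n.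
have ll : l' ^+ 2 <= l ^+ 2 by rewrite lerXn2r.
have p : 0 < 1 + m%:R * tau by rewrite addr_gt0// mulr_gt0// ltr0n.
apply: (@le_trans _ _ (l ^+ 2 * ((1 + m%:R * tau)^-1 / 2))).
  by rewrite -mulrA ler_pM ?sqr_ge0 ?divr_ge0 ?exprn_ge0// ler_wpM2r.
rewrite mulrA ler_pdivrMr// ler_pdivrMr//.
move: hm; rewrite ler_pdivrMr ?mulr_gt0//; nra.
Qed.

End asymptotics.

Section vanishing.
Context {R : realType} (rho : R).
Hypothesis rho01 : 0 < rho <= 1.

Let h : R := binary_entropy rho + rho * ln 2.

Lemma sparse_unit (n K : nat) (x : vec R n) : (0 < n)%N -> rho * n%:R = K%:R ->
  is_sparse n K rho x -> unit_vec x.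
Proof.
move=> n0 rhoE [S [u [cS ->]]]; apply: unit_sparse_vec.
- by split=> //; rewrite rhoE natr_nat.
- by case/andP: rho01.
- by rewrite cS rhoE.
Qed.

(** The number of spikes is at least exp(n h) / (n + 1), so the near pairs vanish once the rate of
    the capped ratio plus the two tilt losses stays below h. *)
Lemma near_term_le (n K : nat) (A tau a delta : R) : (0 < K)%N -> (K <= n)%N ->
  rho * n%:R = K%:R -> 0 <= a * tau ->
  A + a * tau + 4 * expR (- a / 2) - h <= - delta ->
  2 * expR (n%:R * A) *
    (expR (a * tau * K%:R + 4 * n%:R * expR (- a / 2)) / ('C(n, K) * 2 ^ K)%:R) <=
  2 * n.+1%:R * expR (- (n%:R * delta)).
Proof.
move=> K0 Kn rhoE at0 Ad.
have n0 : (0 < K + (n - K))%N by rewrite subnKC// (leq_trans K0).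
have := support_card_bounds K (n - K) n0 rho; rewrite !subnKC// => /(_ rhoE)[_ le2].
have C0 : 0 < ('C(n, K) * 2 ^ K)%:R :> R by rewrite ltr0n muln_gt0 bin_gt0 Kn expn_gt0.
rewrite -!mulrA ler_pM2l// mulrA ler_pdivrMr// mulrAC.
have le3 : expR (- (n%:R * delta)) * expR (n%:R * h) <=
    n.+1%:R * ('C(n, K) * 2 ^ K)%:R * expR (- (n%:R * delta)).
  by rewrite [leLHS]mulrC ler_wpM2r ?expR_ge0.
apply: le_trans le3; rewrite -!expRD ler_expR.
have nK : K%:R <= n%:R :> R by rewrite ler_nat.
have n0' : 0 <= n%:R :> R by [].
have := ler_wpM2l at0 nK; have := ler_wpM2l n0' Ad; rewrite -/h; lra.
Qed.

(** [D], [eta] and [tau] depend on [l1] only. The target [(~~ e)%:R] is 1 for the plain second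
    moment and 0 for the weighted one. *)
Lemma vanishing_second_moment (n0 k0 : nat) (l1 : R) : (0 < n0)%N ->
  rho * n0%:R = k0%:R -> 0 <= l1 -> l1 ^+ 2 / 4 < h ->
  exists (D : nat) (eta tau : R), 0 < eta /\
  forall d l, (D <= d)%N -> 0 <= l <= l1 -> forall c, 0 < c -> forall n1 : nat,
  exists n K, [/\ (n1 <= n)%N, [/\ (0 < n)%N, (0 < K)%N, (K <= n)%N & rho * n%:R = K%:R],
    expR (- (n%:R * eta ^+ 2 / 4)) <= c &
    forall x, is_sparse n K rho x -> forall e : bool,
      prior_avg n K rho (fun x' => (`|dot x x'| ^+ d) ^+ e *
        trunc_corr n d l eta tau (dot x x')) <= (~~ e)%:R + c].
Proof.
move=> n00 rhoE0 l10 l1h; have /andP[rho0 rho1] := rho01.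
have k00 : (0 < k0)%N by rewrite -(ltr_nat R) -rhoE0 mulr_gt0// ltr0n.
have kn0 : (k0 <= n0)%N by rewrite -(ler_nat R) -rhoE0 ler_piMl.
(* The margin [del] is split in four: [eta], the tilt loss a tau, and 4 exp(-a / 2) <= 8 / a each
   use at most del / 4, leaving the rate del / 4 for decay. *)
set del := h - l1 ^+ 2 / 4; have del0 : 0 < del by rewrite subr_gt0.
pose eta := del / (2 * (l1 + 1)); have eta0 : 0 < eta.
  by rewrite divr_gt0// mulr_gt0// ltr_wpDl.
pose a := 32 / del; have a0 : 0 < a by rewrite divr_gt0.
pose tau := del / (4 * a); have tau0 : 0 < tau by rewrite divr_gt0// mulr_gt0.
have [D0 hD] := overlap_decay rho l1 tau rho0 tau0 l10.
(* d >= 5 makes n t^d at most n0 / q for the cut t = 1 / q. *)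
exists (maxn D0 5), eta, tau; split=> // d l; rewrite geq_max => /andP[D0d d5] l01 c c0 n1.
have /andP[l0 ll1] := l01.
pose C1 := 4 / eta ^+ 2; pose C2 := n0%:R * l1 ^+ 2 : R.
pose C3 := 4 * 27 * 16 ^+ 3 : R; pose C4 := 108 / (del / 4) ^+ 3.
have C10 : 0 <= C1 by rewrite divr_ge0 ?sqr_ge0.
have C20 : 0 <= C2 by rewrite mulr_ge0 ?sqr_ge0.
have C30 : 0 <= C3 by rewrite !mulr_ge0 ?exprn_ge0.
have C40 : 0 <= C4 by rewrite divr_ge0// exprn_ge0// divr_ge0// ltW.
(* The atypical event, small, intermediate and near overlaps contribute at most C1 / q, (C2 + 2) /
   q, C3 / q and C4 / q respectively; the extra 2 serves the weighted sum. The summand C2 ensures C2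
   / q <= 1, so that the exponential can be linearised. *)
pose q := (maxn n1 (Num.trunc ((C1 + C2 + C3 + C4 + 2) / c + C2))).+1.
have q0 : 0 < q%:R :> R by rewrite ltr0n.
have q1 : 1 <= q%:R :> R by rewrite ler1n.
have qB : (C1 + C2 + C3 + C4 + 2) / c + C2 <= q%:R.
  by apply: ltW; apply: lt_le_trans (truncnS_gt _) _; rewrite ler_nat ltnS leq_maxr.
have qC : (C1 + C2 + C3 + C4 + 2) / q%:R <= c.
  rewrite ler_pdivrMr// mulrC -ler_pdivrMr//; apply: le_trans qB; by rewrite lerDl.
have qC2 : C2 / q%:R <= 1.
  rewrite ler_pdivrMr// mul1r; apply: le_trans qB; rewrite lerDr divr_ge0 ?(ltW c0)//.
  by rewrite !addr_ge0.
pose n := (n0 * q ^ 4)%N; pose K := (k0 * q ^ 4)%N.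
have rhoE : rho * n%:R = K%:R by rewrite /n /K !natrM mulrA rhoE0.
have nn0 : (0 < n)%N by rewrite muln_gt0 n00 expn_gt0.
have K0 : (0 < K)%N by rewrite muln_gt0 k00 expn_gt0.
have Kn : (K <= n)%N by rewrite leq_mul2r kn0 orbT.
have qn : (q <= n)%N.
  by apply: leq_trans (leq_pmull _ n00); rewrite -[X in (X <= _)%N]expn1 leq_pexp2l.
exists n, K; split=> //.
- by apply: leq_trans qn; rewrite leqW// leq_maxl.
- apply: le_trans (expRN_le_inv _ _) _.
    by rewrite divr_gt0// mulr_gt0 ?ltr0n// exprn_gt0.
  apply: le_trans qC; apply: (@le_trans _ _ (C1 / q%:R)); last first.
    by rewrite ler_pM2r ?invr_gt0// -!addrA lerDl !addr_ge0.
  rewrite (_ : _^-1 = C1 / n%:R); last first.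
    by rewrite /C1; field; rewrite !gt_eqF// ltr0n.
  by rewrite ler_wpM2l// lef_pV2 ?posrE ?ltr0n// ler_nat.
move=> x sx e.
have x1 x' : is_sparse n K rho x' -> `|dot x x'| <= 1.
  move=> sx'; apply: dot_le1; [exact: sparse_unit sx|exact: sparse_unit sx'].
pose t : R := q%:R^-1.
have t0 : 0 <= t by rewrite invr_ge0.
have mid r : 0 <= r <= 1 - tau -> n%:R / 2 * (l ^+ 2 * r ^+ d) <= K%:R / 16 * r ^+ 2.
  move=> r01; have := hD d l D0d l01 r r01; rewrite -rhoE.
  have : 0 <= n%:R :> R by [].
  move=> n0R /(ler_wpM2l n0R); lra.
have := prior_avg_trunc_le n K d rho l eta tau t a K0 Kn rhoE t0 (ltW a0) mid x e sx x1.
move=> /le_trans; apply.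
have qV : 0 <= q%:R^-1 :> R by rewrite invr_ge0.
have b1 : (t ^+ d) ^+ e * expR (n%:R / 2 * (l ^+ 2 * t ^+ d)) <= (~~ e)%:R + (C2 + 2) / q%:R.
  have t1 : t <= 1 by rewrite invf_le1.
  have td : t ^+ d <= t ^+ 5 by rewrite ler_wiXn2l.
  have td1 : t ^+ d <= t.
    by rewrite -[leRHS]expr1 ler_wiXn2l// (leq_trans _ d5).
  have ll : l ^+ 2 <= l1 ^+ 2 by rewrite lerXn2r// nnegrE.
  have le1 : n%:R / 2 * (l ^+ 2 * t ^+ d) <= C2 / q%:R / 2.
    apply: (@le_trans _ _ (n%:R / 2 * (l1 ^+ 2 * t ^+ 5))).
      by rewrite ler_wpM2l ?divr_ge0// ler_pM ?sqr_ge0 ?exprn_ge0.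
    rewrite le_eqVlt; apply/orP; left; apply/eqP.
    by rewrite /C2 /t /n natrM natrX; field; rewrite gt_eqF.
  have ge1 : 0 <= n%:R / 2 * (l ^+ 2 * t ^+ d).
    by rewrite mulr_ge0 ?divr_ge0 ?mulr_ge0 ?sqr_ge0 ?exprn_ge0.
  have le2 : expR (C2 / q%:R / 2) <= 1 + 2 * (C2 / q%:R / 2).
    apply: expR_le_lin; rewrite !divr_ge0//=; lra.
  have le3 : expR (n%:R / 2 * (l ^+ 2 * t ^+ d)) <= 1 + C2 / q%:R.
    apply: (@le_trans _ _ (expR (C2 / q%:R / 2))); first by rewrite ler_expR.
    by apply: le_trans le2 _; lra.
  case: e => /=.
    rewrite expr1 add0r; apply: (@le_trans _ _ (t * 2)).
      by rewrite ler_pM ?exprn_ge0 ?expR_ge0//; apply: le_trans le3 _; lra.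
    by rewrite /t mulrC ler_pM2r ?invr_gt0// lerDr.
  rewrite expr0 mul1r; apply: le_trans le3 _; rewrite lerD2l ler_pM2r ?invr_gt0//.
  by rewrite lerDl.
have b2 : 2 * K.+1%:R * expR (- (t ^+ 2 * K%:R / 16)) <= C3 / q%:R.
  have k01 : 1 <= k0%:R :> R by rewrite ler1n.
  have KE : K%:R = k0%:R * q%:R ^+ 4 :> R by rewrite /K natrM natrX.
  have xE : t ^+ 2 * K%:R / 16 = k0%:R * q%:R ^+ 2 / 16.
    by rewrite KE /t; field; rewrite gt_eqF.
  rewrite xE; have x0 : 0 < k0%:R * q%:R ^+ 2 / 16 :> R.
    by rewrite divr_gt0// mulr_gt0 ?exprn_gt0// ltr0n.
  have KS : K.+1%:R <= 2 * (k0%:R * q%:R ^+ 4) :> R.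
    by rewrite -KE -natrM ler_nat mul2n -addnn -addn1 leq_add2l.
  apply: (@le_trans _ _ (2 * (2 * (k0%:R * q%:R ^+ 4)) * (27 / (k0%:R * q%:R ^+ 2 / 16) ^+ 3))).
    rewrite ler_pM ?mulr_ge0 ?expR_ge0//; first by rewrite ler_pM2l.
    exact: expRN_le_inv3.
  rewrite [leLHS](_ : _ = C3 / q%:R * (k0%:R ^+ 2 * q%:R)^-1); last first.
    by rewrite /C3; field; rewrite !gt_eqF// ltr0n.
  rewrite ler_piMr ?divr_ge0// invf_le1; last by rewrite mulr_gt0 ?exprn_gt0 ?ltr0n.
  by rewrite -[leLHS]mulr1 ler_pM// exprn_ege1.
have b3 : 2 * expR (n%:R * (l ^+ 2 / 4 + l * eta / 2)) *
    (expR (a * tau * K%:R + 4 * n%:R * expR (- a / 2)) / ('C(n, K) * 2 ^ K)%:R) <= C4 / q%:R.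
  have at_ : a * tau = del / 4 by rewrite /tau; field; rewrite gt_eqF.
  have ev : expR (- a / 2) <= del / 16.
    rewrite mulNr; apply: le_trans (expRN_le_inv _ _) _; first by rewrite divr_gt0.
    by rewrite le_eqVlt; apply/orP; left; apply/eqP; rewrite /a; field; rewrite gt_eqF.
  have le_ : l * eta / 2 <= del / 4.
    rewrite /eta (_ : _ / 2 = l / (l1 + 1) * (del / 4)); last first.
      by field; rewrite gt_eqF// ltr_wpDl.
    rewrite ler_piMl ?divr_ge0 ?(ltW del0)// ler_pdivrMr ?mul1r ?ltr_wpDl//.
    by apply: le_trans ll1 _; rewrite lerDl.
  have ll : l ^+ 2 <= l1 ^+ 2 by rewrite lerXn2r// nnegrE.
  apply: le_trans (near_term_le n K _ tau a (del / 4) K0 Kn rhoE _ _) _.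
  - by rewrite mulr_ge0 ?ltW.
  - by rewrite at_ /del in ev le_ *; lra.
  have d4 : 0 < del / 4 by rewrite divr_gt0.
  have n1R : 1 <= n%:R :> R by rewrite ler1n.
  have nR0 : 0 < n%:R :> R by rewrite ltr0n.
  have nS : n.+1%:R <= 2 * n%:R :> R.
    by rewrite -natrM ler_nat mul2n -addnn -addn1 leq_add2l.
  apply: (@le_trans _ _ (2 * (2 * n%:R) * (27 / (n%:R * (del / 4)) ^+ 3))).
    rewrite ler_pM ?mulr_ge0 ?expR_ge0//; first by rewrite ler_pM2l.
    by apply: expRN_le_inv3; rewrite mulr_gt0.
  rewrite [leLHS](_ : _ = C4 / n%:R * n%:R^-1); last first.
    by rewrite /C4; field; rewrite !gt_eqF.
  apply: (@le_trans _ _ (C4 / n%:R)).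
    by apply: ler_piMr; [rewrite divr_ge0|rewrite invf_le1].
  by rewrite ler_wpM2l// lef_pV2 ?posrE// ler_nat.
apply: le_trans (lerD (lerD b1 b2) b3) _.
rewrite -!addrA lerD2l !addrA -!mulrDl; apply: le_trans qC.
rewrite ler_pM2r ?invr_gt0//.
clear -C10; move: C1 C2 C3 C4 C10 => x1 x2 x3 x4 x10; lra.
Qed.

End vanishing.

(** Both notions demand their bound at all large admissible dimensions, so a single dimension beyond
    the given rank refutes them. The claimed advantage itself is taken as the free parameter [k]. *)
Lemma impossible_below {R : realType} (rho : R) (hrho : 0 < rho <= 1)
    (hdims : exists n, sparse_dims rho n) (l1 : R) : 0 <= l1 ->
  l1 ^+ 2 / 4 < binary_entropy rho + rho * ln 2 ->
  exists D : nat, forall d l, (D <= d)%N -> 0 <= l <= l1 ->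
    ~ weak_detection (sparse_dims rho) (spRade rho) l d /\
    ~ weak_recovery (sparse_dims rho) (spRade rho) l d.
Proof.
move=> l10 l1h; have [n0 [n00 /natrP[k0 rhoE0]]] := hdims.
have [D [eta [tau [eta0 H]]]] := vanishing_second_moment rho hrho n0 k0 l1 n00 rhoE0 l10 l1h.
exists D => d l Dd l01; have l0 : 0 <= l by case/andP: l01.
(* The error terms of both bounds are at most k / 4 when eps, D - 1 and D' are at most c k. *)
pose c (k : R) := k ^+ 2 / (8 * (k + 1)).
have c0 k : 0 < k -> 0 < c k.
  by move=> k0_; rewrite divr_gt0 ?exprn_gt0// mulr_gt0// addr_gt0.
have ck k : 0 < k -> c k + c k / k = k / 8.
  by move=> k0_; rewrite /c; field; rewrite !gt_eqF// ltr_wpDl// ltW.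
have setup n K : (0 < n)%N -> (0 < K)%N -> (K <= n)%N -> rho * n%:R = K%:R ->
    [/\ sparse_dims rho n, (0 < size (sparse_seq n rho))%N &
     forall j : 'I_(size (sparse_seq n rho)),
       unit_vec (nth [tuple 0 | _ < n] (sparse_seq n rho) j)].
  move=> nn0 K0 Kn rhoE; split.
  - by split=> //; rewrite rhoE natr_nat.
  - by rewrite (size_sparse_seq n K rho Kn rhoE) muln_gt0 bin_gt0 Kn expn_gt0.
  - move=> j; apply: (sparse_unit rho hrho n K) => //.
    by apply: sparse_seqP => //; exact: mem_nth.
split.
- case=> k k_gt0 [phi [n1 _ Hphi]].
  have [n [K [n1n [nn0 K0 Kn rhoE] eps_le avg_le]]] := H d l Dd l01 (c k) (c0 k k_gt0) n1.
  have [dn s0 us] := setup n K nn0 K0 Kn rhoE.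
  have := Hphi n n1n dn; apply/negP; rewrite -ltNge.
  apply: le_lt_trans (detection_bound _ (sparse_seq n rho) (spRade rho) erefl nn0 s0 us
    l eta tau k l0 eta0 k_gt0 (phi n)) _.
  have avg0 := avg_le _ _ false.
  have B := pair_avg_le n K rho Kn rhoE [tuple 0 | _ < n]
    (fun x x' => trunc_corr n d l eta tau (dot x x')) (1 + c k).
  rewrite lte_fin ltrD2l; move: B; set S := _ * _ => B.
  have {}B : S <= 1 + c k.
    apply: B => x sx; apply: le_trans (avg_le x sx false); rewrite le_eqVlt; apply/orP; left.
    by apply/eqP; congr prior_avg; apply/funext => x'; rewrite expr0 mul1r.
  have kV : 0 <= k^-1 by rewrite invr_ge0 ltW.
  have e1 : expR (- (n%:R * eta ^+ 2 / 4)) / k <= c k / k by rewrite ler_wpM2r.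
  have e2 : (S - 1) / (2 * k) <= c k / k / 2.
    rewrite (_ : c k / k / 2 = c k / (2 * k)); last by field; rewrite gt_eqF.
    by rewrite ler_wpM2r ?invr_ge0 ?mulr_ge0 ?(ltW k_gt0)// lerBlDl.
  have := ck k k_gt0; have := c0 k k_gt0; lra.
- case=> k k_gt0 [xhat uxhat [n1 _ Hx]].
  have [n [K [n1n [nn0 K0 Kn rhoE] eps_le avg_le]]] := H d l Dd l01 (c k) (c0 k k_gt0) n1.
  have [dn s0 us] := setup n K nn0 K0 Kn rhoE.
  have := Hx n n1n dn; apply/negP; rewrite -ltNge.
  apply: le_lt_trans (recovery_bound _ (sparse_seq n rho) (spRade rho) erefl nn0 s0 us
    l eta tau k l0 eta0 k_gt0 (xhat n) (uxhat n dn)) _.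
  have B := pair_avg_le n K rho Kn rhoE [tuple 0 | _ < n]
    (fun x x' => `|dot x x'| ^+ d * trunc_corr n d l eta tau (dot x x')) (c k).
  rewrite lte_fin; move: B; set S := _ * _ => B.
  have {}B : S <= c k.
    by apply: B => x sx; have := avg_le x sx true; rewrite add0r.
  have e2 : S / (2 * k) <= c k / k / 2.
    rewrite (_ : c k / k / 2 = c k / (2 * k)); last by field; rewrite gt_eqF.
    by rewrite ler_wpM2r ?invr_ge0 ?mulr_ge0 ?(ltW k_gt0).
  have ckk : 0 <= c k / k by rewrite divr_ge0 ?ltW// c0.
  have := ck k k_gt0; have := c0 k k_gt0; lra.
Qed.

(** * The scan statistic *)

Definition mfun_of {d1 d2} {T1 : measurableType d1} {T2 : measurableType d2}
    (f : T1 -> T2) (mf : measurable_fun setT f) : {mfun T1 >-> T2} :=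
  HB.pack f (isMeasurableFun.Build _ _ _ _ f mf).

Section scan.
Context {R : realType} {n d : nat}.
Implicit Types (s : seq (vec R n)) (t y : tensor R n d).

Definition above (c : R) t (x : vec R n) : bool := c < tdot (tpow x) t.

(** Choosing the first candidate over the threshold, rather than a maximiser, gives nested
    conditionals, whose measurability follows by induction. *)
Fixpoint first_above (c : R) (x0 : vec R n) s t : vec R n :=
  if s is x :: s' then if above c t x then x else first_above c x0 s' t else x0.

Lemma measurable_above c x : measurable_fun setT (fun t => above c t x).
Proof. by apply: measurable_fun_ltr => //; exact: measurable_tdot. Qed.

Lemma measurable_has_above c s : measurable_fun setT (fun t => has (above c t) s).
Proof.
elim: s => [|x s IH] //=.
by apply: measurable_or => //; exact: measurable_above.
Qed.

Lemma measurable_first_above c x0 s : measurable_fun setT (first_above c x0 s).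
Proof.
elim: s => [|x s IH] /=; first exact: measurable_cst.
by apply: measurable_fun_ifT => //; exact: measurable_above.
Qed.

Lemma first_aboveP c x0 s t : has (above c t) s ->
  first_above c x0 s t \in s /\ above c t (first_above c x0 s t).
Proof.
elim: s => [|x s IH] //=; case: ifP => [h _|_ /= /IH[m a]]; rewrite inE ?eqxx//.
by rewrite m orbT.
Qed.

Lemma mem_first_above c x0 s t : first_above c x0 s t \in x0 :: s.
Proof.
elim: s => [|x s IH] /=; first by rewrite inE.
by case: ifP => _; rewrite !inE ?eqxx ?orbT//; move: IH; rewrite inE => /orP[->|->]; rewrite ?orbT.
Qed.

Hypothesis n0 : (0 < n)%N.
Local Open Scope ereal_scope.
Notation Q := (iid_noise R n d).

Lemma has_above_tail c s : (0 < c)%R -> (forall x, x \in s -> unit_vec x) ->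
  \int[Q]_y (has (above c y) s)%:R%:E <= ((size s)%:R * expR (- (n%:R * c ^+ 2 / 4)))%:E.
Proof.
move=> c0; elim: s => [|x s IH] us.
  by rewrite mul0r; under eq_integral do rewrite /=; rewrite integral0.
have nx : ge0_mfun (fun y => (above c y x)%:R : R) by apply: ge0_mfun_bool; exact: measurable_above.
have ns : ge0_mfun (fun y => (has (above c y) s)%:R : R).
  by apply: ge0_mfun_bool; exact: measurable_has_above.
apply: (@le_trans _ _ (\int[Q]_y ((above c y x)%:R + (has (above c y) s)%:R)%:E)).
  apply: le_expect; [|exact: ge0_mfunD|].
    by apply: ge0_mfun_bool; exact: (measurable_has_above c (x :: s)).
  by move=> y /=; rewrite -natrD ler_nat; case: (above _ _ _); case: (has _ _).
rewrite ge0_expectD// [size _]/= -(natr1 (size s)) (addrC (size s)%:R) mulrDl mul1r EFinD.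
apply: leeD; last first.
  by apply: IH => x' x's; apply: us; rewrite inE x's orbT.
apply: le_trans (noise_tail (d := d) n0 c x _); last by apply: us; rewrite inE eqxx.
apply: le_expect => //.
  apply: ge0_mfun_bool; apply: measurable_fun_ler => //.
  by apply: measurable_funM => //; exact: measurable_tdot.
move=> y; rewrite ler_nat /above; case: ltP => // h.
by rewrite expr2 ler_pM2l// ltW.
Qed.

End scan.

(** * Enumeration of the spikes without repetition *)

Section candidates.
Context {R : realType} (n K : nat) (rho : R).
Hypothesis Kn : (K <= n)%N.
Hypothesis rhoE : rho * n%:R = K%:R.

(** Signs are indexed by subsets of the support, so the list has C(n, K) 2^K entries. [sparse_seq]
    repeats each spike 2^(n - K) times, which would spoil the union bound. *)
Definition candidates : seq (vec R n) :=
  [seq sparse_vec rho p.1 [ffun i => i \in p.2]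
     | p : {set 'I_n} * {set 'I_n} <- enum predT
     & (#|p.1|%:R == rho * n%:R) && (p.2 \subset p.1)].

Lemma size_candidates : size candidates = ('C(n, K) * 2 ^ K)%N.
Proof.
rewrite size_map size_filter -sum1_count big_enum_cond/=.
transitivity (\sum_(S : {set 'I_n} | #|S| == K) \sum_(A : {set 'I_n} | A \subset S) 1)%N.
  by rewrite pair_big_dep/=; apply: eq_bigl => p; rewrite rhoE eqr_nat.
rewrite (eq_bigr (fun=> 2 ^ K)%N); last first.
  move=> S /eqP cS; rewrite -cS -card_powerset -sum1_card; apply: eq_bigl => A.
  by rewrite powersetE.
rewrite sum_nat_const; congr (_ * _)%N.
rewrite -[in RHS](card_ord n) -card_draws.
by apply: eq_card => S; rewrite !inE.
Qed.

Lemma candidates_sparse x : x \in candidates -> is_sparse n K rho x.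
Proof.
move=> /mapP[[S A]]; rewrite mem_filter rhoE eqr_nat => /andP[/andP[/eqP cS _] _] ->.
by exists S, [ffun i => i \in A].
Qed.

Lemma sparse_candidates x : is_sparse n K rho x -> x \in candidates.
Proof.
move=> [S [u [cS ->]]]; apply/mapP; exists (S, finset (fun i => (i \in S) && u i)).
  rewrite mem_filter mem_enum andbT /= rhoE cS eqxx/=.
  by apply/fintype.subsetP => i; rewrite inE => /andP[].
apply: eq_from_tnth => i; rewrite !tnth_mktuple ffunE inE.
by case: (i \in S).
Qed.

End candidates.

(** * Performance of the scan test and of the scan estimate *)

Section scan_statistic.
Context {R : realType} (rho : R) (n d : nat) (e : R).
Hypothesis rho01 : 0 < rho <= 1.
Hypothesis dn : sparse_dims rho n.
Hypothesis e0 : 0 < e.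

Let h : R := binary_entropy rho + rho * ln 2.
Let Lam : R := 2 * Num.sqrt h.
(** Three margins of size [e]: pure noise stays below Lam + e, the threshold is Lam + 2 e, and the
    planted spike scores above l - e, which equals the threshold. *)
Let l : R := Lam + 3 * e.
Let cand := candidates n rho.
Let x0 : vec R n := nth [tuple 0 | _ < n] cand 0.
Let s := sparse_seq n rho : seq (vec R n).
Let b : R := expR (- (n%:R * e ^+ 2 / 4)).
Notation Q := (iid_noise R n d).

Definition scan_test (t : tensor R n d) : bool :=
  has (above (2 * Num.sqrt (binary_entropy rho + rho * ln 2) + 2 * e) t) (candidates n rho).

Definition scan_estimate (t : tensor R n d) : vec R n :=
  first_above (2 * Num.sqrt (binary_entropy rho + rho * ln 2) + 2 * e)
    (nth [tuple 0 | _ < n] (candidates n rho) 0) (candidates n rho) t.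

Let n0 : (0 < n)%N. Proof. by case: dn. Qed.

Let KP : exists2 K, rho * n%:R = K%:R & (0 < K <= n)%N.
Proof.
have [_ /natrP[K rhoE]] := dn; exists K => //; have /andP[r0 r1] := rho01.
rewrite -(ltr_nat R) -(ler_nat R) -rhoE mulr_gt0 ?ltr0n//=.
by rewrite ler_piMl.
Qed.

Let h0 : 0 <= h.
Proof.
have /andP[r0 r1] := rho01; rewrite /h /binary_entropy addr_ge0//; last first.
  by rewrite mulr_ge0 ?(ltW r0)// ln_ge0// ler1n.
rewrite -opprD oppr_ge0 -[leRHS](addr0 0) lerD//.
  by rewrite mulr_ge0_le0 ?(ltW r0)// ln_le0.
by rewrite mulr_ge0_le0 ?subr_ge0// ln_le0// gerBl ltW.
Qed.

Let Lam0 : 0 <= Lam. Proof. by rewrite mulr_ge0// sqrtr_ge0. Qed.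
Let Lam2 : Lam ^+ 2 = 4 * h.
Proof. by rewrite exprMn sqr_sqrtr//; ring. Qed.
Let l0 : 0 < l. Proof. by rewrite ltr_wpDl// mulr_gt0. Qed.

Let cand_unit x : x \in cand -> unit_vec x.
Proof.
have [K rhoE /andP[K0 Kn]] := KP.
by move=> /(candidates_sparse n K rho rhoE)/(sparse_unit rho rho01 n K x n0 rhoE).
Qed.

Let s_cand x : x \in s -> x \in cand.
Proof.
have [K rhoE /andP[K0 Kn]] := KP.
by move=> /(sparse_seqP n K rho rhoE)/(sparse_candidates n K rho rhoE).
Qed.

Let s0 : (0 < size s)%N.
Proof.
have [K rhoE /andP[K0 Kn]] := KP.
by rewrite (size_sparse_seq n K rho Kn rhoE) muln_gt0 bin_gt0 Kn expn_gt0.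
Qed.

Let z : vec R n := [tuple 0 | _ < n].
Notation J := 'I_(size s).
Let x_ (j : J) : vec R n := nth z s j.
Let xc j : x_ j \in cand. Proof. exact/s_cand/mem_nth. Qed.
Let ux j : unit_vec (x_ j). Proof. exact/cand_unit/xc. Qed.

Lemma scan_estimate_unit t : unit_vec (scan_estimate t).
Proof.
have : scan_estimate t \in x0 :: cand by exact: mem_first_above.
rewrite inE => /orP[/eqP ->|/cand_unit//]; apply/cand_unit/mem_nth.
by have := xc (Ordinal s0); case: (cand).
Qed.

Local Open Scope ereal_scope.

(** The constant 2 sqrt h is the level c at which the tail rate c^2 / 4 balances the growth rate h
    of the number of candidates; the margin [e] leaves at least e^2 / 4. *)
Let noise_above : \int[Q]_y (has (above (Lam + e)%R y) cand)%:R%:E <= b%:E.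
Proof.
have [K rhoE /andP[K0 Kn]] := KP.
have c0 : (0 < Lam + e)%R by rewrite ltr_wpDl.
apply: le_trans (has_above_tail n0 _ cand c0 cand_unit) _.
have nK : (0 < K + (n - K))%N by rewrite subnKC.
have := support_card_bounds K (n - K) nK rho; rewrite !subnKC// => /(_ rhoE)[le1 _].
rewrite lee_fin (size_candidates n K rho rhoE).
apply: (@le_trans _ _ (expR (n%:R * h) * expR (- (n%:R * (Lam + e) ^+ 2 / 4))))%R.
  by rewrite ler_wpM2r ?expR_ge0.
rewrite -expRD ler_expR sqrrD Lam2.
have : (0 <= n%:R * (Lam * e))%R by rewrite !mulr_ge0// ltW.
rewrite -mulr_natl; lra.
Qed.

Let low (j : J) (y : tensor R n d) := (tdot (tpow (x_ j)) y <= - e)%R.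

Let noise_low j : \int[Q]_y (low j y)%:R%:E <= b%:E.
Proof.
have := noise_tail (d := d) n0 (- e)%R (x_ j) (ux j); rewrite sqrrN.
apply: le_trans; apply: le_expect.
- apply: ge0_mfun_bool; apply: measurable_fun_ler => //; exact: measurable_tdot.
- apply: ge0_mfun_bool; apply: measurable_fun_ler => //.
  by apply: measurable_funM => //; exact: measurable_tdot.
- move=> y; rewrite ler_nat /low; case: (leP _ (- e)%R) => // hy.
  by have -> : (e ^+ 2 <= - e * tdot (tpow (x_ j)) y)%R by have := ler_wpM2l (ltW e0) hy; lra.
Qed.

Let mtest : measurable_fun setT scan_test.
Proof. exact: measurable_has_above. Qed.

Let mestimate : measurable_fun setT scan_estimate.
Proof. exact: measurable_first_above. Qed.

Let mlow j : measurable_fun setT (low j).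
Proof. by apply: measurable_fun_ler => //; exact: measurable_tdot. Qed.

Let spike_above j y : ~~ low j y ->
  above (2 * Num.sqrt h + 2 * e)%R (spike_plus_noise l (x_ j, symmetrize y)) (x_ j).
Proof.
rewrite /low -ltNge /above tdot_spike tdot_tpow ux expr1n mulr1 tdot_symmetrize.
by rewrite /l /Lam; lra.
Qed.

Lemma scan_test_success :
  (1 - b)%:E <= success_prob (spRade rho) l scan_test <= 1.
Proof.
have mneg : measurable_fun setT (fun t => ~~ scan_test t) by exact: measurable_neg.
have mA : measurable [set t | scan_test t] by rewrite -[X in measurable X]setTI; exact: mtest.
have mAN : measurable [set t | ~~ scan_test t] by rewrite -[X in measurable X]setTI; exact: mneg.
have WTn : (1 - b)%:E <= WT R n d [set t | ~~ scan_test t].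
  have -> : [set t | ~~ scan_test t] = ~` [set t | scan_test t].
    by apply/seteqP; split=> t /= /negP.
  rewrite probability_setC// EFinB leeB// prob_bool// ge0_integral_WT//; last first.
    by apply/measurable_EFinP; apply: (ge0_mfun_bool _ _).1.
  apply: le_trans noise_above; apply: le_expect.
  - apply: ge0_mfun_bool; apply: measurableT_comp => //; exact: measurable_symmetrize.
  - by apply: ge0_mfun_bool; exact: measurable_has_above.
  - move=> y; rewrite ler_nat; case: (boolP (scan_test _)) => // /hasP[x xc' h1].
    rewrite lt0b; apply/hasP; exists x => //; move: h1; rewrite /above.
    by rewrite tdot_symmetrize; apply: lt_trans; rewrite ltrD2l ltr_pMl// ltr1n.
have Pn : (1 - b)%:E <= spikedWT (spRade rho) l n d [set t | scan_test t].
  have mpsp : measurable_fun setT (fun p => scan_test (@spike_plus_noise R n d l p)).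
    by apply: measurableT_comp => //; exact: measurable_spike_plus_noise.
  rewrite -[leRHS]/(spike_noise_law (spRade rho) n d [set p | scan_test (spike_plus_noise l p)]).
  rewrite prob_bool// (ge0_integral_spike_noise z s _ erefl s0)//; last first.
    by apply/measurable_EFinP; apply: (ge0_mfun_bool _ _).1.
  have N0 : (0 < (size s)%:R^-1 :> R)%R by rewrite invr_gt0 ltr0n.
  have -> : (1 - b)%:E = ((size s)%:R^-1)%:E * \sum_(j : J) (1 - b)%:E.
    rewrite sumEFin -EFinM sumr_const card_ord -(mulr_natl (1 - b)) mulKf//.
    by rewrite pnatr_eq0 -lt0n.
  rewrite lee_pmul2l//; apply: lee_sum => j _.
  have mt : measurable_fun setT (fun y : tensor R n d =>
      scan_test (spike_plus_noise l (x_ j, symmetrize y))).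
    apply: (measurableT_comp mpsp).
    by apply: measurable_fun_pair => //; exact: measurable_symmetrize.
  rewrite EFinB leeBlDr//.
  apply: (@le_trans _ _ (\int[Q]_y ((scan_test (spike_plus_noise l (x_ j, symmetrize y)))%:R +
      (low j y)%:R)%:E)); last first.
    by rewrite ge0_expectD ?leeD2l//; exact: ge0_mfun_bool.
  rewrite -[leLHS](expect_cst Q); apply: le_expect.
  - exact: ge0_mfun_cst.
  - by apply: ge0_mfunD; exact: ge0_mfun_bool.
  - move=> y; case: (boolP (low j y)) => [_|/spike_above hs]; first by rewrite lerDr.
    by rewrite /scan_test (_ : has _ _) ?lerDl//; apply/hasP; exists (x_ j).
apply/andP; split.
  rewrite /success_prob; apply: (@le_trans _ _ ((2^-1)%:E * ((1 - b)%:E + (1 - b)%:E))).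
    by rewrite -EFinD -EFinM lee_fin; lra.
  by rewrite lee_pmul2l// leeD.
rewrite /success_prob; apply: (@le_trans _ _ ((2^-1)%:E * (1 + 1))).
  by rewrite lee_pmul2l// leeD// probability_le1.
by rewrite -EFinD -EFinM lee_fin; lra.
Qed.

(** A selected v satisfies l <x, v>^d + noise > Lam + 2 e with noise at most Lam + e, hence <x, v>^d
    > e / l. Each of the two bad events has probability at most [b] and costs at most 2, whence 4
    b. *)
Lemma scan_estimate_overlap :
  (e / l - 4 * b)%:E <= 'E_(spike_noise_law (spRade rho) n d)[(fun p =>
    dot p.1 (scan_estimate (spike_plus_noise l p)) ^+ d)%R].
Proof.
have mspike := @measurable_spike_plus_noise R n d l.
have mx : measurable_fun setT (fun p => scan_estimate (@spike_plus_noise R n d l p)).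
  exact: measurableT_comp.
set f := fun p : vec R n * tensor R n d => (dot p.1 (scan_estimate (spike_plus_noise l p)) ^+ d)%R.
have mf : measurable_fun setT f.
  apply: measurable_funX; apply: measurable_sum => i; apply: measurable_funM.
    by apply: (measurableT_comp (measurable_tnth _)); exact: measurable_fst.
  exact: (measurableT_comp (measurable_tnth _) mx).
have f1 (j : J) t : (`|f (nth z s j, t)| <= 1)%R.
  rewrite /f normrX exprn_ile1// dot_le1//; [exact: (ux j)|exact: scan_estimate_unit].
have := expectation_spiked_ge z s (spRade rho) erefl s0 f mf f1.
set W := (_ * _) => le1.
have el : (e / l <= 1)%R by rewrite ler_pdivrMr ?mul1r /l//; have := e0; have := Lam0; lra.
have WB : W <= (1 - e / l + 4 * b)%:E.
  have N0 : (0 < (size s)%:R^-1 :> R)%R by rewrite invr_gt0 ltr0n.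
  have -> : (1 - e / l + 4 * b)%:E = ((size s)%:R^-1)%:E * \sum_(j : J) (1 - e / l + 4 * b)%:E.
    rewrite sumEFin -EFinM sumr_const card_ord -(mulr_natl (1 - _ + _)) mulKf//.
    by rewrite pnatr_eq0 -lt0n.
  rewrite lee_pmul2l//; apply: lee_sum => j _.
  have nl : ge0_mfun (fun y : tensor R n d => (low j y)%:R : R) by exact: ge0_mfun_bool.
  have na : ge0_mfun (fun y : tensor R n d => (has (above (Lam + e)%R y) cand)%:R : R).
    by apply: ge0_mfun_bool; exact: measurable_has_above.
  have nla : ge0_mfun (fun y : tensor R n d => 2 * ((low j y)%:R + (has (above (Lam + e)%R y) cand)%:R) : R)%R.
    by apply: ge0_mfunM; [exact: ge0_mfun_cst|exact: ge0_mfunD].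
  apply: (@le_trans _ _ (\int[Q]_y ((1 - e / l) +
      2 * ((low j y)%:R + (has (above (Lam + e)%R y) cand)%:R))%:E)).
    apply: le_expect.
    - split=> [|y]; last by have := f1 j (symmetrize y); rewrite ler_norml; lra.
      apply: measurable_funB => //; apply: (measurableT_comp mf).
      by apply: measurable_fun_pair => //; exact: measurable_symmetrize.
    - by apply: ge0_mfunD => //; apply: ge0_mfun_cst; rewrite subr_ge0.
    - move=> y; have := f1 j (symmetrize y); rewrite ler_norml => /andP[f2 _].
      case: (boolP (low j y)) => [_|nlow].
        case: (has _ _); rewrite /=; lra.
      case: (boolP (has _ _)) => [_|/hasPn nab]; first by rewrite /=; lra.
      rewrite addr0 mulr0 addr0 lerD2l lerN2.
      have hs : has (above (2 * Num.sqrt h + 2 * e)%R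
          (spike_plus_noise l (x_ j, symmetrize y))) cand.
        by apply/hasP; exists (x_ j) => //; exact: spike_above.
      have [] := first_aboveP _ x0 _ _ hs.
      rewrite -/(scan_estimate _) /f; set v := scan_estimate _ => vc.
      rewrite /above tdot_spike tdot_tpow tdot_symmetrize => va.
      have := nab _ vc; rewrite /above -leNgt => vb.
      rewrite ler_pdivrMr// mulrC (_ : dot (x_ j) v = dot v (x_ j)).
        by rewrite /Lam in vb; lra.
      by apply: eq_bigr => i _; rewrite mulrC.
  rewrite ge0_expectD//; last by apply: ge0_mfun_cst; rewrite subr_ge0.
  rewrite expect_cst ge0_expectZ//; last exact: ge0_mfunD.
  rewrite ge0_expectD// (EFinD (1 - e / l)%R) leeD2l//.
  rewrite (_ : (4 * b)%:E = 2%:E * (b%:E + b%:E)); last first.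
    by rewrite -EFinD -EFinM; congr _%:E; ring.
  by rewrite lee_pmul2l// leeD.
move: le1 => /le_trans-/(_ _ (leeD2l _ WB)).
rewrite -leeBlDr// -EFinB; congr (_ <= _); congr _%:E; ring.
Qed.

End scan_statistic.

(** * The threshold *)

Lemma possible_above {R : realType} (rho : R) (d : nat) (l : R) : 0 < rho <= 1 ->
  2 * Num.sqrt (binary_entropy rho + rho * ln 2) < l ->
  strong_detection (sparse_dims rho) (spRade rho) l d /\
  weak_recovery (sparse_dims rho) (spRade rho) l d.
Proof.
set Lam := 2 * _ => rho01 Ll.
pose e := (l - Lam) / 3; have e0 : 0 < e by rewrite divr_gt0// subr_gt0.
have lE : l = Lam + 3 * e by rewrite /e; field.
have Lam0 : 0 <= Lam by rewrite mulr_ge0// sqrtr_ge0.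
have l0 : 0 < l by apply: le_lt_trans Ll.
(* The exponential is traded for a multiple of the harmonic sequence, using n + 1 <= 2 n; this fixes
   the constant 8. *)
have b_le (n : nat) : (0 < n)%N -> expR (- (n%:R * e ^+ 2 / 4)) <= 8 / e ^+ 2 * n.+1%:R^-1.
  move=> n0; have n0R : 0 < n%:R :> R by rewrite ltr0n.
  apply: le_trans (expRN_le_inv _ _) _; first by rewrite divr_gt0// mulr_gt0// exprn_gt0.
  rewrite (_ : _^-1 = 8 / e ^+ 2 * (2 * n%:R)^-1); last by field; rewrite !gt_eqF.
  rewrite ler_pM2l ?divr_gt0 ?exprn_gt0// lef_pV2 ?posrE ?mulr_gt0//.
  by rewrite -natrM ler_nat mul2n -addnn -addn1 leq_add2l.
have cvg0 : 8 / e ^+ 2 * n.+1%:R^-1 @[n --> \oo] --> (0 : R).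
  rewrite -(mulr0 (8 / e ^+ 2)); apply: cvgMr; exact: cvg_harmonic.
split.
  exists (fun n => mfun_of _ (measurable_has_above (n := n) (d := d) (Lam + 2 * e) (candidates n rho))).
  apply: (@squeeze_cvge _ _ _ _ (fun n => (1 - 8 / e ^+ 2 * n.+1%:R^-1)%:E) _ (cst 1%E)).
  - exists 0%N => // n _ dn; have n0 : (0 < n)%N by case: dn.
    have := scan_test_success rho n d e rho01 dn e0; rewrite -/Lam -lE => /andP[h1 h2].
    apply/andP; split; last exact: h2.
    by apply: le_trans h1; rewrite lee_fin lerD2l lerN2 b_le.
  - apply: cvg_EFin; first by exists 0%N.
    have cvg1 : 1 - 8 / e ^+ 2 * n.+1%:R^-1 @[n --> \oo] --> (1 : R).
      by rewrite -[X in _ --> X]subr0; apply: cvgB cvg0; exact: cvg_cst.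
    move=> A /cvg1 [m _ hA]; exists m => // n mn _; exact: hA.
  - exact: cvg_cst.
have el0 : 0 < e / (2 * l) by rewrite divr_gt0// mulr_gt0.
exists (e / (2 * l)) => //.
exists (fun n => mfun_of _ (measurable_first_above (n := n) (d := d) (Lam + 2 * e)
  (nth [tuple 0 | _ < n] (candidates n rho) 0) (candidates n rho))).
  by move=> n dn t; exact: (scan_estimate_unit rho n d e rho01 dn).
(* With b <= e / (8 l) the loss 4 b is at most half of e / l. *)
have [/= n1 _ small] : \forall n \near \oo, 8 / e ^+ 2 * n.+1%:R^-1 <= e / (8 * l).
  have := cvgr_lt _ cvg0 _ (divr_gt0 e0 (mulr_gt0 (ltr0n R 8) l0)).
  by case=> m _ hm; exists m => // n /hm; exact: ltW.
exists n1 => // n n1n dn; have n0 : (0 < n)%N by case: dn.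
have := scan_estimate_overlap rho n d e rho01 dn e0; rewrite -/Lam -lE.
apply: le_trans; rewrite lee_fin.
have := le_trans (b_le n n0) (small n n1n).
rewrite (_ : e / (8 * l) = e / l / 8); last by field; rewrite gt_eqF.
rewrite (_ : e / (2 * l) = e / l / 2); last by field; rewrite gt_eqF.
by move=> bs; lra.
Qed.

Theorem theorem1p5 (R : realType) (rho : R) (hrho : 0 < rho <= 1)
    (hdims : exists n, sparse_dims rho n) :
  exists lstar : nat -> R,
    (lstar d @[d --> \oo] --> 2 * Num.sqrt (binary_entropy rho + rho * ln 2)) /\
    forall d : nat, (3 <= d)%N ->
      (forall l : R, 0 <= l -> l < lstar d ->
         ~ weak_detection (sparse_dims rho) (spRade rho) l d /\
         ~ weak_recovery (sparse_dims rho) (spRade rho) l d) /\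
      (forall l : R, 2 * Num.sqrt (binary_entropy rho + rho * ln 2) < l ->
         strong_detection (sparse_dims rho) (spRade rho) l d /\
         weak_recovery (sparse_dims rho) (spRade rho) l d).
Proof.
set Lam := 2 * Num.sqrt _.
have Lam0 : 0 <= Lam by rewrite mulr_ge0// sqrtr_ge0.
pose impossible d l := ~ weak_detection (sparse_dims rho) (spRade rho) l d /\
  ~ weak_recovery (sparse_dims rho) (spRade rho) l d.
(* The bound for each d is the supremum of the levels up to [Lam] below which both tasks are
   impossible. Level 0 qualifies vacuously, so it exists for every d, and impossibility below it
   holds by construction; only the limit requires the second moment estimate. *)
pose E d := [set m : R | 0 <= m <= Lam /\ forall l, 0 <= l < m -> impossible d l].
have E0 d : E d 0 by split=> [|l /andP[a b]]; [rewrite lexx|move: (le_lt_trans a b); rewrite ltxx].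
have Eub d : ubound (E d) Lam by move=> m [/andP[]].
have sup_le d : sup (E d) <= Lam by apply: ge_sup => //; exists 0; exact: E0.
exists (fun d => sup (E d)); split; last first.
  move=> d d3; split=> [l l0 lE|l]; last exact: possible_above.
  have [|m [_ Em] lm] := sup_gt _ lE; first by exists 0; exact: E0.
  by apply: Em; rewrite l0.
apply/cvgrPdist_le => eps eps0.
(* The maximum keeps the level nonnegative when eps exceeds [Lam]. *)
pose l1 := Num.max 0 (Lam - eps).
have l10 : 0 <= l1 by rewrite le_max lexx.
have l1Lam : l1 <= Lam by rewrite ge_max Lam0 gerBl ltW.
suff [D HD] : exists D, forall d, (D <= d)%N -> E d l1.
  exists D => // d Dd; rewrite ger0_norm ?subr_ge0// lerBlDr -lerBlDl.
  apply: (@le_trans _ _ l1); first by rewrite le_max lexx orbT.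
  by apply: ub_le_sup; [exists Lam; exact: Eub|exact: HD].
have [Lam_eq0|LamN0] := eqVneq Lam 0.
  exists 0%N => d _; have -> : l1 = 0 by apply/eqP; rewrite eq_le l10 -Lam_eq0 l1Lam.
  exact: E0.
have LamP : 0 < Lam by rewrite lt_neqAle eq_sym LamN0.
have h0 : 0 < binary_entropy rho + rho * ln 2.
  by rewrite -sqrtr_gt0; move: LamP; rewrite pmulr_rgt0.
have l1lt : l1 < Lam by rewrite gt_max LamP gtrBl.
have l1h : l1 ^+ 2 / 4 < binary_entropy rho + rho * ln 2.
  have : l1 ^+ 2 < Lam ^+ 2 by rewrite ltrXn2r.
  by rewrite exprMn sqr_sqrtr ?(ltW h0)//; lra.
have [D HD] := impossible_below rho hrho hdims l1 l10 l1h.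
exists D => d Dd; split=> [|l /andP[l0 ll1]]; first by rewrite l10.
by apply: HD => //; rewrite l0 ltW.
Qed.
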